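(* For every $s=(y,i)\in\mathbb Z_p\times\mathbb Z/(q^d-1)$ we have $$\xi_{-s}(\Theta_{\mathcal F_S/F,S})(X)=L_{\mathfrak p}(X,y,\omega_{\mathfrak p}^i).$$
   Context: $\mathbb F$ is a finite field with $q\ge3$ elements and characteristic $p$; $A=\mathbb F[\theta]$, $F=\mathbb F(\theta)$, $\infty$ is the place of $F$ corresponding to $1/\theta$; $A_{+,n}$ is the set of monic polynomials of degree $n$; $\mathfrak p$ is a nonzero prime of $A$ of degree $d$; $S=\{\mathfrak p,\infty\}$. $A_{\mathfrak p}$ is the completion of $A$ at $\mathfrak p$, $\mathbb C_{\mathfrak p}$ the completion of an algebraic closure of its fraction field, and $\mathbb F_{\mathfrak p}=A/\mathfrak p$ is regarded as a subring of $A_{\mathfrak p}$ by lifting nonzero elements to roots of unity. $U_1=1+\mathfrak pA_{\mathfrak p}$; for $u\in U_1$, $y\in\mathbb Z_p$, $u^y=\sum_{n\ge0}\binom yn(u-1)^n$. $\omega_{\mathfrak p}:A_{\mathfrak p}\to\mathbb F_{\mathfrak p}\hookrightarrow A_{\mathfrak p}$ is reduction followed by the lift; for $a\in A_{\mathfrak p}^*$ write $a=\omega_{\mathfrak p}(a)\langle a\rangle_{\mathfrak p}$ with $\langle a\rangle_{\mathfrak p}\in U_1$. $\mathfrak p$-adic $L$-function: $L_{\mathfrak p}(X,y,\omega_{\mathfrak p}^i)=\sum_{n\ge0}\Big(\sum_{a\in A_{+,n}-\mathfrak p}\omega_{\mathfrak p}^i(a)\langle a\rangle_{\mathfrak p}^y\Big)X^n\in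 A_{\mathfrak p}[[X]]$. Stickelberger series: $\mathcal F_S$ is the maximal abelian extension of $F$ unramified outside $S$, $G_S=\mathrm{Gal}(\mathcal F_S/F)$, and $\Theta_{\mathcal F_S/F,S}(X)=\prod_{\mathfrak q\notin S}(1-\mathrm{Fr}_{\mathfrak q}^{-1}X^{\deg\mathfrak q})^{-1}\in\mathbb Z[G_S][[X]]$ (product over places $\mathfrak q\notin S$ of $F$, $\mathrm{Fr}_{\mathfrak q}\in G_S$ the arithmetic Frobenius). A homomorphism $\xi:G_S\to\mathbb C_{\mathfrak p}^*$ is applied coefficientwise. Cyclotomic tower: $\Phi$ is the Carlitz module ($\Phi_\theta=\theta\tau^0+\tau$ in $F\{\tau\}$, $\tau f=f^q\tau$), $\mathcal F=\bigcup_nF(\Phi[\mathfrak p^{n}])\subset\mathcal F_S$ with $\Phi[\mathfrak p^n]$ the $\mathfrak p^n$-torsion, $G_\infty=\mathrm{Gal}(\mathcal F/F)$. Extending $\Phi$ to a formal Drinfeld module over $A_{\mathfrak p}$, $\kappa:G_\infty\to A_{\mathfrak p}^*$ is the isomorphism with $\sigma(\varepsilon)=\Phi_{\kappa(\sigma)}(\varepsilon)$ for all $\varepsilon\in\Phi[\mathfrak p^\infty]$. For $s=(y,i)\in\mathbb Z_p\times\mathbb Z/(q^d-1)$ and $a\in A_{\mathfrak p}^*$ put $a^s=\omega_{\mathfrak p}^i(a)\langle a\rangle_{\mathfrak p}^y$; then $\xi_s:G_S\to\mathbb C_{\mathfrak p}^*$ is the continuous homomorphism $\xi_s(\sigma)=\kappa(\sigma|_{\mathcal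 F})^s$. *)

(* Defs.v *)
From HB Require Import structures.
From mathcomp Require Import all_boot all_order all_algebra separable.
From mathcomp Require Import finmap.
From mathcomp Require Import boolp classical_sets functions reals.
From mathcomp.multinomials Require Import monalg.

Set Implicit Arguments.
Unset Strict Implicit.
Unset Printing Implicit Defensive.

Import Order.TTheory GRing.Theory Num.Theory.
Local Open Scope classical_set_scope.
Local Open Scope ring_scope.

Definition dvdr (C : comNzRingType) (b x : C) : Prop := exists y, x = b * y.

Definition adic_cvg (C : comNzRingType) (pi : C) (u : nat -> C) (l : C) : Prop :=
  forall m, exists N, forall n, (N <= n)%N -> dvdr (pi ^+ m) (u n - l).

Definition adic_lim (C : comNzRingType) (pi : C) (u : nat -> C) : C :=
  xget 0 [set l | adic_cvg pi u l].

(* [f] exhibits [C] as the [pi]-adic completion of [R]: [C] is separated and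
   complete for the [f pi]-adic topology, and [f] induces isomorphisms
   R / pi^n -> C / pi^n, so that C = lim R / pi^n. *)
Record adic_completion (R C : comNzRingType) (pi : R) (f : {rmorphism R -> C}) :
    Prop := AdicCompletion {
  adic_inj : forall n a, dvdr (f pi ^+ n) (f a) -> dvdr (pi ^+ n) a;
  adic_dense : forall n x, exists a, dvdr (f pi ^+ n) (x - f a);
  adic_separated : forall x, (forall n, dvdr (f pi ^+ n) x) -> x = 0;
  adic_complete : forall u : nat -> C,
    (forall n, dvdr (f pi ^+ n) (u n.+1 - u n)) ->
    exists l, adic_cvg (f pi) u l }.

Definition pseries (R : Type) := nat -> R.

Section PowerSeries.
Variable R : nzRingType.

Definition ps_one : pseries R := fun n => (n == 0%N)%:R.

Definition ps_mul (f g : pseries R) : pseries R :=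
  fun n => \sum_(k < n.+1) f k * g (n - k)%N.

Definition ps_inv (f : pseries R) : pseries R :=
  xget ps_one [set g | ps_mul f g = ps_one /\ ps_mul g f = ps_one].

End PowerSeries.

Definition group_ring (G : groupType) : Type := {malg int[G]}.

Section GroupRing.
Variable G : groupType.
Implicit Types (x y z : group_ring G) (g h : G).

HB.instance Definition _ := GRing.Zmodule.on (group_ring G).

Definition gr_of g : group_ring G := mkmalgU g 1.

Definition gr_mul x y : group_ring G :=
  \sum_(g <- msupp x) \sum_(h <- msupp y)
    mkmalgU (g * h)%g (mcoeff g x * mcoeff h y).

Let gr_mulw (d1 d2 : {fset G}) x y :
  (msupp x `<=` d1)%fset -> (msupp y `<=` d2)%fset ->
  gr_mul x y = \sum_(g <- d1) \sum_(h <- d2)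
    mkmalgU (g * h)%g (mcoeff g x * mcoeff h y).
Proof.
move=> le1 le2; rewrite /gr_mul (big_fset_incl _ le1) /=.
  apply/eq_bigr=> g _; apply/big_fset_incl => // h _ /mcoeff_outdom ->.
  by rewrite mulr0 monalgU0.
move=> g _ /mcoeff_outdom xg.
by rewrite big1 // => h _; rewrite xg mul0r monalgU0.
Qed.

Let gr_mulUU g h a b :
  gr_mul (mkmalgU g a) (mkmalgU h b) = mkmalgU (g * h)%g (a * b).
Proof. by rewrite (gr_mulw msuppU_le msuppU_le) !big_seq_fset1 !mcoeffUU. Qed.

Let gr_mulDl : left_distributive gr_mul +%R.
Proof.
move=> x y z.
rewrite [X in X = _](gr_mulw (msuppD_le x y) (fsubset_refl _)).
rewrite [X in _ = X + _](gr_mulw (fsubsetUl _ (msupp y)) (fsubset_refl _)).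
rewrite [X in _ = _ + X](gr_mulw (fsubsetUr (msupp x) _) (fsubset_refl _)).
rewrite -big_split /=; apply/eq_bigr=> g _.
rewrite -big_split /=; apply/eq_bigr=> h _.
by rewrite mcoeffD mulrDl monalgUD.
Qed.

Let gr_mulDr : right_distributive gr_mul +%R.
Proof.
move=> z x y.
rewrite [X in X = _](gr_mulw (fsubset_refl _) (msuppD_le x y)).
rewrite [X in _ = X + _](gr_mulw (fsubset_refl _) (fsubsetUl _ (msupp y))).
rewrite [X in _ = _ + X](gr_mulw (fsubset_refl _) (fsubsetUr (msupp x) _)).
rewrite -big_split /=; apply/eq_bigr=> g _.
rewrite -big_split /=; apply/eq_bigr=> h _.
by rewrite mcoeffD mulrDr monalgUD.
Qed.

Let gr_mul0l z : gr_mul 0 z = 0.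
Proof. by rewrite /gr_mul msupp0 big_seq_fset0. Qed.

Let gr_mul0r z : gr_mul z 0 = 0.
Proof. by rewrite /gr_mul big1 // => g _; rewrite msupp0 big_seq_fset0. Qed.

Let gr_suml (I : Type) (s : seq I) (f : I -> group_ring G) z :
  gr_mul (\sum_(i <- s) f i) z = \sum_(i <- s) gr_mul (f i) z.
Proof. exact: (big_morph (gr_mul^~ z) (fun _ _ => gr_mulDl _ _ _) (gr_mul0l z)). Qed.

Let gr_sumr (I : Type) (s : seq I) (f : I -> group_ring G) z :
  gr_mul z (\sum_(i <- s) f i) = \sum_(i <- s) gr_mul z (f i).
Proof. exact: (big_morph (gr_mul z) (fun _ _ => gr_mulDr _ _ _) (gr_mul0r z)). Qed.

Let gr_expand x :
  x = \sum_(g <- msupp x) (mkmalgU g (mcoeff g x) : group_ring G).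
Proof. exact: monalgE. Qed.

Let gr_mulA : associative gr_mul.
Proof.
move=> x y z; rewrite [x]gr_expand !gr_suml; apply/eq_bigr=> g _.
rewrite [y]gr_expand gr_suml !gr_sumr gr_suml; apply/eq_bigr=> h _.
rewrite [z]gr_expand !gr_sumr; apply/eq_bigr=> k _.
by rewrite !gr_mulUU mulrA mulgA.
Qed.

Let gr_mul1l : left_id (gr_of 1%g) gr_mul.
Proof.
move=> x; rewrite [x]gr_expand gr_sumr; apply/eq_bigr=> g _.
by rewrite gr_mulUU mul1r mul1g.
Qed.

Let gr_mul1r : right_id (gr_of 1%g) gr_mul.
Proof.
move=> x; rewrite [x]gr_expand gr_suml; apply/eq_bigr=> g _.
by rewrite gr_mulUU mulr1 mulg1.
Qed.

Let gr_one_neq0 : gr_of 1%g != 0.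
Proof. by rewrite /gr_of monalgU_eq0. Qed.

HB.instance Definition _ := GRing.Zmodule_isNzRing.Build (group_ring G)
  gr_mulA gr_mul1l gr_mul1r gr_mulDl gr_mulDr gr_one_neq0.

Definition gr_ext (C : zmodType) (xi : G -> C) (x : group_ring G) : C :=
  \sum_(g <- msupp x) xi g *~ mcoeff g x.

End GroupRing.

Section Galois.
Variables (K E : fieldType) (iota : {rmorphism K -> E}).

Record intermediate (L : set E) : Prop := Intermediate {
  intermediate_base : forall a, L (iota a);
  intermediateB : forall x y, L x -> L y -> L (x - y);
  intermediateM : forall x y, L x -> L y -> L (x * y);
  intermediateV : forall x, L x -> L x^-1 }.

Definition adjoin (B : set E) : set E := smallest intermediate B.

(* As for [Aut] in MathComp, an automorphism of [L] over [K] is a map on the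
   ambient field which is the identity outside [L]. *)
Record is_aut (L : set E) (s : E -> E) : Prop := IsAut {
  aut_bij : set_bij L L s;
  aut_out : forall x, ~ L x -> s x = x;
  aut_base : forall a, s (iota a) = iota a;
  autD : forall x y, L x -> L y -> s (x + y) = s x + s y;
  autM : forall x y, L x -> L y -> s (x * y) = s x * s y }.

Record autg (L : set E) := Autg { autg_fun :> E -> E; autgP : is_aut L autg_fun }.

HB.instance Definition _ (L : set E) := gen_eqMixin (autg L).
HB.instance Definition _ (L : set E) := gen_choiceMixin (autg L).

Section GalGroup.
Variable L : set E.
Implicit Types s t : autg L.

Lemma autg_inj s t : (s : E -> E) = t -> s = t.
Proof.
case: s t => [s sP] [t tP] /= st; case: _ / st tP => tP.
by rewrite (Prop_irrelevance sP tP).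
Qed.

Let autgL s x : L x -> L (s x).
Proof. by case: (autgP s) => -[+ _ _] _ _ _ _; apply. Qed.

Lemma autg_bij s : bijective s.
Proof.
case: (autgP s) => -[sL s_inj s_surj] s_out _ _ _.
have stab x : L (s x) -> L x.
  by move=> Lsx; apply: contrapT => /[dup] nLx /s_out sx; apply: nLx; rewrite -sx.
have inj : injective s.
  move=> x y sxy; have [Lx|nLx] := pselect (L x).
    have Ly : L y by apply: stab; rewrite -sxy; apply: autgL.
    by apply: s_inj => //; rewrite inE.
  have nLy : ~ L y by move=> Ly; apply: nLx; apply: stab; rewrite sxy; apply: autgL.
  by rewrite -(s_out x) // -(s_out y).
have surj y : exists x, s x = y.
  have [/s_surj[x _ <-]|/s_out <-] := pselect (L y); first by exists x.
  by exists y.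
pose t y := projT1 (cid (surj y)).
have tK : cancel t s by move=> y; exact: projT2 (cid (surj y)).
by exists t => // x; apply: inj; rewrite tK.
Qed.

Definition autg_inv_fun s (y : E) : E := xget y [set x | s x = y].

Let autg_invK s : cancel (autg_inv_fun s) s.
Proof.
move=> y; rewrite /autg_inv_fun; case: xgetP => [x _ ->//|].
by have [t _ ts] := autg_bij s; move=> /(_ (t y)) []; exact: ts.
Qed.

Let autgK s : cancel s (autg_inv_fun s).
Proof. by move=> x; apply: (bij_inj (autg_bij s)); rewrite autg_invK. Qed.

Let autg_invL s x : L x -> L (autg_inv_fun s x).
Proof. by case: (autgP s) => -[_ _ +] _ _ _ _ => /[apply] -[y Ly <-]; rewrite autgK. Qed.

Lemma autg_one_subproof : is_aut L id.
Proof. by split=> //; split=> // x Lx; exists x. Qed.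
Definition autg_one := Autg autg_one_subproof.

Lemma autg_mul_subproof s t : is_aut L (s \o t).
Proof.
have [_ so sb sD sM] := autgP s; have [_ to tb tD tM] := autgP t.
split=> [|x nLx|a|x y Lx Ly|x y Lx Ly] /=; first split.
- by move=> x Lx; apply/autgL/autgL.
- by move=> x y _ _ /(bij_inj (autg_bij s))/(bij_inj (autg_bij t)).
- move=> y Ly; exists (autg_inv_fun t (autg_inv_fun s y)).
    exact/autg_invL/autg_invL.
  by rewrite /= !autg_invK.
- by rewrite to // so.
- by rewrite tb sb.
- by rewrite tD // sD //; exact: autgL.
- by rewrite tM // sM //; exact: autgL.
Qed.
Definition autg_mul s t := Autg (autg_mul_subproof s t).

Lemma autg_inv_subproof s : is_aut L (autg_inv_fun s).
Proof.
have [_ so sb sD sM] := autgP s.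
split=> [|x nLx|a|x y Lx Ly|x y Lx Ly]; first split.
- by move=> x Lx; exact: autg_invL.
- by move=> x y _ _ /(can_inj (autg_invK s)).
- by move=> y Ly; exists (s y); [exact: autgL|rewrite autgK].
- by rewrite -{1}(so x nLx) autgK.
- by rewrite -{1}(sb a) autgK.
- by apply: (bij_inj (autg_bij s)); rewrite sD ?autg_invK //; exact: autg_invL.
- by apply: (bij_inj (autg_bij s)); rewrite sM ?autg_invK //; exact: autg_invL.
Qed.
Definition autg_inv s := Autg (autg_inv_subproof s).

Let autg_mulA : associative autg_mul.
Proof. by move=> s t u; apply: autg_inj. Qed.
Let autg_mul1g : left_id autg_one autg_mul.
Proof. by move=> s; apply: autg_inj. Qed.
Let autg_mulg1 : right_id autg_one autg_mul.
Proof. by move=> s; apply: autg_inj. Qed.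
Let autg_mulVg : left_inverse autg_one autg_inv autg_mul.
Proof. by move=> s; apply: autg_inj; apply/funext => x /=; rewrite autgK. Qed.
Let autg_mulgV : right_inverse autg_one autg_inv autg_mul.
Proof. by move=> s; apply: autg_inj; apply/funext => x /=; rewrite autg_invK. Qed.

HB.instance Definition _ := isGroup.Build (autg L)
  autg_mulA autg_mul1g autg_mulg1 autg_mulVg autg_mulgV.

End GalGroup.

(* Restriction of automorphisms to a subextension [M] of [L]; it is meaningful
   when [M] is stable under [s], and is the identity otherwise. *)
Definition autg_res (L M : set E) (s : autg L) : autg M :=
  match pselect (is_aut M (fun x => if `[< M x >] then s x else x)) with
  | left sP => Autg sP
  | right _ => autg_one M
  end.

(* [L] is separable and normal over [K], when [E] is algebraically closed. *)
Definition galois_ext (L : set E) : Prop :=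
  forall x, L x -> exists f : {poly K},
    [/\ separable_poly f, root (map_poly iota f) x
      & forall y, root (map_poly iota f) y -> L y].

Definition abelian_ext (L : set E) : Prop :=
  galois_ext L /\ forall s t : autg L, (s * t = t * s)%g.

End Galois.

Section FunctionField.
Variable F : finFieldType.
Notation A := {poly F}.
Notation q := #|F|.

(* The finite places of F(theta) are the monic irreducible polynomials. *)
Definition is_prime (Q : A) : Prop := Q \is monic /\ irreducible_poly Q.

Definition deg (a : A) : nat := (size a).-1.

(* A_{+,n} *)
Definition monics (n : nat) : seq A := [seq 'X^n + rVpoly v | v : 'rV[F]_n].

Lemma mem_monics n (a : A) :
  (a \in monics n) = (a \is monic) && (size a == n.+1).
Proof.
apply/mapP/andP => [[v _ ->]|[/monicP am /eqP an]].
  have sv : (size (rVpoly v) < size ('X^n : A))%N.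
    by rewrite size_polyXn ltnS size_poly.
  by rewrite monicE lead_coefDl // lead_coefXn size_polyDl // size_polyXn !eqxx.
exists (poly_rV (a - 'X^n)); first by rewrite mem_enum.
rewrite poly_rV_K; first by rewrite addrC subrK.
apply/leq_sizeP => k; rewrite leq_eqVlt coefB coefXn => /predU1P[<-|nk].
  by move: am; rewrite lead_coefE an /= eqxx => ->; rewrite subrr.
by rewrite gtn_eqF // subr0 nth_default // an.
Qed.

Lemma uniq_monics n : uniq (monics n).
Proof.
rewrite map_inj_uniq ?enum_uniq // => v w /addrI.
exact: (can_inj rVpolyK).
Qed.

Definition primes_upto (P : A) (n : nat) : seq A :=
  [seq Q <- flatten [seq monics k | k <- iota 1 n]
     | `[< irreducible_poly Q >] && (Q != P)].

(* The ring A{tau} of twisted polynomials; the polynomial \sum_i f_i 'X^i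
   stands for \sum_i f_i tau^i, and tau f = f^q tau. *)
Definition twmul (f g : {poly A}) : {poly A} :=
  \sum_(i < size f) \sum_(j < size g) (f`_i * g`_j ^+ (q ^ i)) *: 'X^(i + j).

(* The Carlitz module, the morphism of F-algebras A -> A{tau} that maps theta
   to theta tau^0 + tau; theta is 'X : A. *)
Definition carlitz (a : A) : {poly A} :=
  \sum_(k < size a) (a`_k)%:P *: iter k (twmul ('X%:P + 'X)) 1.

Section Extension.
Variables (E : fieldType) (iota : {rmorphism {fraction A} -> E}).

Definition ofA (a : A) : E := iota (tofrac a).

Definition carlitz_eval (a : A) (x : E) : E :=
  \sum_(i < size (carlitz a)) ofA (carlitz a)`_i * x ^+ (q ^ i).

Definition torsion (a : A) : set E := [set x | carlitz_eval a x = 0].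

Definition cyclotomic_tower (P : A) : set E :=
  \bigcup_n adjoin iota (torsion (P ^+ n)).

(* Places of [L] are given by their valuation rings. *)
Definition nonunits (V : set E) : set E := [set x | V x /\ (x = 0 \/ ~ V x^-1)].

Record place_above (L : set E) (Q : A) (V : set E) : Prop := PlaceAbove {
  place_sub : V `<=` L;
  placeB : forall x y, V x -> V y -> V (x - y);
  placeM : forall x y, V x -> V y -> V (x * y);
  place_total : forall x, L x -> V x \/ V x^-1;
  place_base : forall a, V (ofA a);
  place_center : forall a, nonunits V (ofA a) <-> Q %| a }.

(* Ramification index 1; the residue fields of F(theta) are finite, so that
   residue extensions are automatically separable. *)
Definition unramified_at (L : set E) (Q : A) : Prop :=
  forall V, place_above L Q V ->
  forall x, nonunits V x -> exists2 y, V y & x = ofA Q * y.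

(* Unramified outside S = {P, oo}. *)
Definition unramified_outside (L : set E) (P : A) : Prop :=
  forall Q, is_prime Q -> Q <> P -> unramified_at L Q.

(* Maximal abelian extension of F(theta) unramified outside S: the compositum
   of all the abelian extensions unramified outside S. *)
Definition max_abelian (P : A) : set E :=
  adjoin iota (\bigcup_(L in [set L | [/\ intermediate iota L,
    abelian_ext iota L & unramified_outside L P]]) L).

(* [s] is the Frobenius x |-> x^(N Q) at some place of [L] above [Q]; when [L]
   is abelian and unramified at [Q] it does not depend on that place. *)
Definition is_frobenius (L : set E) (Q : A) (s : autg iota L) : Prop :=
  exists2 V, place_above L Q V
    & forall x, V x -> nonunits V (s x - x ^+ (q ^ deg Q)).

(* Since 1 - Fr^-1 X^(deg Q) = 1 mod X^(n+1) when deg Q > n, the coefficient of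
   X^n in the infinite product is that of the product over deg Q <= n. *)
Definition stickelberger (L : set E) (P : A) (Fr : A -> autg iota L) :
    pseries (group_ring (autg iota L)) :=
  fun n => (\big[@ps_mul _/@ps_one _]_(Q <- primes_upto P n)
    ps_inv (fun k => (k == 0%N)%:R - gr_of (Fr Q)^-1%g *+ (k == deg Q))) n.

End Extension.

Section Adic.
Variables (p : nat) (P : A).
Variables (Ap : comUnitRingType) (iA : {rmorphism A -> Ap}).
Variables (Zp : comNzRingType) (iZ : {rmorphism int -> Zp}).

Definition padic_binom (y : Zp) (n : nat) : Zp :=
  xget 0 [set b | n`!%:R * b = \prod_(k < n) (y - k%:R)].

(* The structural map Zp -> Zp / p -> Ap, Ap being of characteristic p. *)
Definition Zp_to_Ap (b : Zp) : Ap :=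
  xget 0 [set c | exists2 m : int, dvdr (iZ p%:Z) (b - iZ m) & c = m%:~R].

(* u^y for u a 1-unit *)
Definition unit_pow (u : Ap) (y : Zp) : Ap :=
  adic_lim (iA P)
    (fun N => \sum_(n < N) Zp_to_Ap (padic_binom y n) * (u - 1) ^+ n).

Definition teichmuller (a : Ap) : Ap :=
  xget 0 [set w | dvdr (iA P) (a - w) /\ (w = 0 \/ w ^+ (q ^ deg P - 1) = 1)].

Definition one_unit (a : Ap) : Ap := a / teichmuller a.

(* a^s for s = (y, i) *)
Definition adic_pow (a : Ap) (s : Zp * 'Z_(q ^ deg P - 1)) : Ap :=
  teichmuller a ^+ s.2 * unit_pow (one_unit a) s.1.

Definition adic_L (y : Zp) (i : 'Z_(q ^ deg P - 1)) : pseries Ap :=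
  fun n => \sum_(a <- monics n | ~~ (P %| a))
    teichmuller (iA a) ^+ i * unit_pow (one_unit (iA a)) y.

(* Coefficient of tau^i in the image of [a] under the formal Drinfeld module
   Ap -> Ap{{tau}}, the continuous extension of [carlitz]. *)
Definition formal_carlitz (a : Ap) (i : nat) : Ap :=
  xget 0 [set c | forall u : nat -> A, adic_cvg (iA P) (iA \o u) a ->
                  adic_cvg (iA P) (fun n => iA (carlitz (u n))`_i) c].

Section Cp.
Variables (R : realType) (Cp : fieldType) (iC : {rmorphism Ap -> Cp}).
Variable v : Cp -> R.

Definition cvg_abs (u : nat -> Cp) (l : Cp) : Prop :=
  forall e, 0 < e -> exists N, forall n, (N <= n)%N -> v (u n - l) < e.

Definition cauchy_abs (u : nat -> Cp) : Prop :=
  forall e, 0 < e -> exists N, forall m n,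
    (N <= m)%N -> (N <= n)%N -> v (u m - u n) < e.

Definition algebraic_over_Ap : set Cp :=
  [set x | exists2 f : {poly Ap}, f != 0 & root (map_poly iC f) x].

(* [Cp], with its absolute value [v], is the completion of an algebraic closure
   of the fraction field of [Ap]. *)
Record is_Cp : Prop := IsCp {
  Cp_ge0 : forall x, 0 <= v x;
  Cp_eq0 : forall x, v x = 0 <-> x = 0;
  Cp_mul : forall x y, v (x * y) = v x * v y;
  Cp_ultra : forall x y, v (x + y) <= Num.max (v x) (v y);
  Cp_int : forall a, v (iC a) <= 1;
  Cp_unif : v (iC (iA P)) = (q ^ deg P)%:R^-1;
  Cp_closed : forall f : {poly Cp}, (1 < size f)%N ->
    (forall i, algebraic_over_Ap f`_i) ->
    exists2 x, algebraic_over_Ap x & root f x;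
  Cp_dense : forall x e, 0 < e ->
    exists2 y, algebraic_over_Ap y & v (x - y) < e;
  Cp_complete : forall u, cauchy_abs u -> exists l, cvg_abs u l }.

Section Kappa.
Variables (E : fieldType) (iota : {rmorphism {fraction A} -> E}).
Variable j : {rmorphism E -> Cp}.

(* kappa(s) is the unit [a] of [Ap] with s(e) = Phi_a(e) for all e in
   Phi[P^oo], the series Phi_a(e) being evaluated in [Cp]. *)
Definition kappa (s : autg iota (cyclotomic_tower iota P)) : Ap :=
  xget 1 [set a | a \is a GRing.unit /\
    forall n e, torsion iota (P ^+ n) e ->
      cvg_abs (fun N => \sum_(i < N) iC (formal_carlitz a i) * j e ^+ (q ^ i))
              (j (s e))].

Definition xi (s : Zp * 'Z_(q ^ deg P - 1))
    (g : autg iota (max_abelian iota P)) : Cp :=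
  iC (adic_pow (kappa (autg_res (cyclotomic_tower iota P) g)) s).

End Kappa.
End Cp.
End Adic.
End FunctionField.

(* Main.v *)
(* Write Phi_Q for the action of Q on torsion points. Modulo a prime Q <> P of
   degree d, Phi_Q is the d-th power of tau, and Phi_(P^n) is a separable
   polynomial; so F(Phi[P^n]) is unramified at Q, and the Frobenius at Q, which
   is congruent to the q^d-th power map, must act on Phi[P^oo] exactly as Phi_Q.
   It follows that kappa(Fr_Q) = Q. Expanding the Euler product of the
   Stickelberger series over the primes Q <> P gives, by unique factorisation,
   the sum over monic a prime to P of Fr_a^-1 X^(deg a), where kappa(Fr_a) = a,
   and xi_(-s) sends Fr_a^-1 to (a^-1)^(-s) = a^s. *)

Require Import Defs.
From HB Require Import structures.
From mathcomp Require Import all_boot all_order all_algebra all_field.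
From mathcomp Require Import boolp classical_sets reals.
From mathcomp Require Import finmap zify ring.
From mathcomp.multinomials Require Import monalg.

Set Implicit Arguments.
Unset Strict Implicit.
Unset Printing Implicit Defensive.

Import Order.TTheory GRing.Theory Num.Theory.
Local Open Scope ring_scope.

(** * Adic completions *)

(** Limits, [kappa], restrictions of automorphisms and inverse series are defined by choice, so each
    must be shown to exist and to be unique. In A_P and Z_p this is done by congruences: u^y is
    compared with u^m for natural numbers m close to y, and the formal Phi_a with Phi_u for
    polynomials u close to a. Identifying [kappa] takes two facts: Phi[P^n] has a generator whose
    annihilator is exactly (P^n), which gives uniqueness, and |e| < 1 for every torsion point e,
    which makes the series Phi_a(e) converge in C_P.

    The maximal extension is a compositum, so F(Phi[P^n]) lies in it only once it is known to be
    abelian and unramified. Places are arbitrary valuation rings centred at Q; in place of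
    discreteness, an algebraic equation over A bounds the divisibility by Q.

    The Euler product is expanded in a fixed order. Each monic a yields one group element w(a),
    together with the invariant that w(a) inverts Phi_a on Phi[P^oo]; its image under [kappa] is
    then read off from this action. *)

Section Divisibility.
Variable C : comNzRingType.
Implicit Types b x y : C.

Lemma dvdr0 b : dvdr b 0.
Proof. by exists 0; rewrite mulr0. Qed.

Lemma dvdrr b : dvdr b b.
Proof. by exists 1; rewrite mulr1. Qed.

Lemma dvdrD b x y : dvdr b x -> dvdr b y -> dvdr b (x + y).
Proof. by move=> [u ->] [w ->]; exists (u + w); rewrite mulrDr. Qed.

Lemma dvdrN b x : dvdr b x -> dvdr b (- x).
Proof. by move=> [u ->]; exists (- u); rewrite mulrN. Qed.

Lemma dvdrB b x y : dvdr b x -> dvdr b y -> dvdr b (x - y).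
Proof. by move=> bx /dvdrN; apply: dvdrD. Qed.

Lemma dvdr_mull b x y : dvdr b y -> dvdr b (x * y).
Proof. by move=> [u ->]; exists (x * u); rewrite mulrCA. Qed.

Lemma dvdr_mulr b x y : dvdr b x -> dvdr b (x * y).
Proof. by rewrite mulrC; apply: dvdr_mull. Qed.

Lemma dvdr_mul b b' x y : dvdr b x -> dvdr b' y -> dvdr (b * b') (x * y).
Proof. by move=> [u ->] [w ->]; exists (u * w); rewrite mulrACA. Qed.

Lemma dvdr_trans b x y : dvdr b x -> dvdr x y -> dvdr b y.
Proof. by move=> [u ->] [w ->]; exists (u * w); rewrite mulrA. Qed.

Lemma dvdr_exp2 b m n : (m <= n)%N -> dvdr (b ^+ m) (b ^+ n).
Proof. by move=> mn; exists (b ^+ (n - m)); rewrite -exprD subnKC. Qed.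

Lemma dvdr_expW b m n x : (m <= n)%N -> dvdr (b ^+ n) x -> dvdr (b ^+ m) x.
Proof. by move=> /(dvdr_exp2 b)/dvdr_trans; apply. Qed.

Lemma dvdr_sum b (I : Type) (s : seq I) (Q : pred I) (h : I -> C) :
  (forall i, Q i -> dvdr b (h i)) -> dvdr b (\sum_(i <- s | Q i) h i).
Proof.
move=> bh; elim/big_ind: _ => //; [exact: dvdr0 | exact: dvdrD].
Qed.

Lemma dvdr_exp b x n : dvdr b x -> dvdr (b ^+ n) (x ^+ n).
Proof. by move=> [u ->]; exists (u ^+ n); rewrite exprMn. Qed.

Lemma dvdr_subX b x y n : dvdr b (x - y) -> dvdr b (x ^+ n - y ^+ n).
Proof. by rewrite subrXX; apply: dvdr_mulr. Qed.

(* Congruences [x = y mod b] are written [dvdr b (x - y)]. *)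
Lemma dvdr_sub_trans b y x z : dvdr b (x - y) -> dvdr b (y - z) -> dvdr b (x - z).
Proof. by move=> /dvdrD h /h; rewrite addrA subrK. Qed.

Lemma dvdr_sub_sym b x y : dvdr b (x - y) -> dvdr b (y - x).
Proof. by move=> /dvdrN; rewrite opprB. Qed.

Lemma dvdr_subM b x y z t :
  dvdr b (x - y) -> dvdr b (z - t) -> dvdr b (x * z - y * t).
Proof.
move=> xy zt; rewrite (_ : _ - _ = (x - y) * z + y * (z - t)); last by ring.
by apply: dvdrD; [apply: dvdr_mulr | apply: dvdr_mull].
Qed.

Lemma dvdr_prod_sub b (I : Type) (s : seq I) (Q : pred I) (h k : I -> C) :
  (forall i, Q i -> dvdr b (h i - k i)) ->
  dvdr b (\prod_(i <- s | Q i) h i - \prod_(i <- s | Q i) k i).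
Proof.
move=> bhk; elim/big_rec2: _ => [|i x y /bhk bi bxy]; first by rewrite subrr; exact:
  dvdr0.
exact: dvdr_subM.
Qed.

End Divisibility.

Lemma dvdr_rmorph (R C : comNzRingType) (f : {rmorphism R -> C}) b x :
  dvdr b x -> dvdr (f b) (f x).
Proof. by move=> [y ->]; exists (f y); rewrite rmorphM. Qed.

Section Completion.
Variables (R C : comNzRingType) (pi : R) (f : {rmorphism R -> C}).
Hypothesis hC : adic_completion pi f.

Lemma adic_eq x y : (forall n, dvdr (f pi ^+ n) (x - y)) -> x = y.
Proof. by move=> h; apply/eqP; rewrite -subr_eq0; apply/eqP/(adic_separated hC). Qed.

Lemma adic_dvd n a : dvdr (f pi ^+ n) (f a) <-> dvdr (pi ^+ n) a.
Proof.
split; first exact: (adic_inj hC).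
by move=> /(dvdr_rmorph f); rewrite rmorphXn.
Qed.

Lemma adic_cvg_unique u l l' : adic_cvg (f pi) u l -> adic_cvg (f pi) u l' -> l = l'.
Proof.
move=> ul ul'; apply: adic_eq => n; have [N uN] := ul n; have [N' uN'] := ul' n.
have := uN _ (leq_maxl N N'); have := uN' _ (leq_maxr N N').
move=> h /dvdr_sub_sym h'; exact: dvdr_sub_trans h' h.
Qed.

Lemma adic_limE u l : adic_cvg (f pi) u l -> adic_lim (f pi) u = l.
Proof.
move=> ul; rewrite /adic_lim; case: xgetP => [x _ ux|/(_ l) []//].
exact: adic_cvg_unique ux ul.
Qed.

(** Telescoping adds a rate of convergence to [adic_complete]: the n-th term already agrees with the
    limit modulo pi^n. Limits built below are used through these congruences. *)
Lemma adic_complete_rate (u : nat -> C) :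
  (forall n, dvdr (f pi ^+ n) (u n.+1 - u n)) ->
  exists l, forall n, dvdr (f pi ^+ n) (u n - l).
Proof.
move=> hu; have [l ul] := adic_complete hC hu; exists l => n.
have [N hN] := ul n; apply: (dvdr_sub_trans _ (hN _ (leq_maxl N n))).
have : (n <= maxn N n)%N by rewrite leq_maxr.
elim: (maxn N n) => [|k IH]; first by rewrite leqn0 => /eqP ->; rewrite subrr; exact:
  dvdr0.
rewrite leq_eqVlt => /predU1P[-> | nk]; first by rewrite subrr; exact: dvdr0.
apply: dvdr_sub_trans (IH nk) _; apply: dvdr_sub_sym.
exact: (dvdr_expW (n := k)).
Qed.

End Completion.

(** * Powers of one-units with p-adic exponents *)

Section Zp.
Variables (p : nat) (pr_p : prime p) (Zp : comNzRingType).
Variables (iZ : {rmorphism int -> Zp}) (hZp : adic_completion p%:Z iZ).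
Notation pi := (iZ p%:Z).

Lemma Zp_dvd_nat K m : dvdr (pi ^+ K) (m%:R : Zp) <-> (p ^ K %| m)%N.
Proof.
have -> : (m%:R : Zp) = iZ m%:Z by rewrite -natz rmorph_nat.
rewrite (adic_dvd hZp) -[p%:Z]natz -natrX natz; split=> [[z hz]|/dvdnP[k ->]].
  by have /= := dvdz_mulr z (dvdzz (p ^ K)%N); rewrite -hz dvdzE.
by exists k%:Z; rewrite mulnC PoszM.
Qed.

Lemma Zp_approx K (y : Zp) : exists m : nat, dvdr (pi ^+ K) (y - m%:R).
Proof.
have [a ha] := adic_dense hZp K y; exists `|(a %% p%:Z ^+ K)%Z|%N.
apply: dvdr_sub_trans ha _.
rewrite -[_%:R](rmorph_nat iZ) natz gez0_abs; last first.
  by rewrite modz_ge0 // expf_neq0 // eqz_nat -lt0n prime_gt0.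
rewrite -rmorphB -rmorphXn; apply: dvdr_rmorph.
by exists (a %/ p%:Z ^+ K)%Z; rewrite {1}(divz_eq a (p%:Z ^+ K)) addrK mulrC.
Qed.

(** Division by k costs v_p(k) digits. [Zp] is an abstract ring, so the cancellation is carried out
    in [nat], on a natural number m close enough to x, by comparing p-adic valuations. *)
Lemma Zp_dvd_cancel k K (x : Zp) : (0 < k)%N ->
  dvdr (pi ^+ (K + logn p k)) (k%:R * x) -> dvdr (pi ^+ K) x.
Proof.
move=> k0 hk; have [m hm] := Zp_approx (K + logn p k) x.
suff : dvdr (pi ^+ K) (m%:R : Zp).
  by move=> /(dvdrD (dvdr_expW (leq_addr _ _) hm)); rewrite subrK.
apply/Zp_dvd_nat; have [->|m0] := posnP m; first by rewrite dvdn0.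
have : dvdr (pi ^+ (K + logn p k)) ((k * m)%:R : Zp).
  by have := dvdrB hk (dvdr_mull k%:R hm); rewrite mulrBr subKr -natrM.
move=> /Zp_dvd_nat; rewrite !pfactor_dvdn ?muln_gt0 ?k0 //.
by rewrite lognM // addnC leq_add2l.
Qed.

Lemma prod_sub_ffact (S : comNzRingType) m n :
  \prod_(k < n) (m%:R - k%:R) = (m ^_ n)%:R :> S.
Proof.
elim: n => [|n IH]; first by rewrite big_ord0.
rewrite big_ord_recr /= IH ffactnSr natrM.
have [nm|mn] := leqP n m; first by rewrite natrB.
by rewrite ffact_small // !mul0r.
Qed.

(** Dividing the product of the y - k by n! loses v_p(n!) digits, hence the precision asked of m.
    The chosen value exists as the limit of the integers C(a_k, n) for naturals a_k tending to y;
    [prodE] compares any solution of the defining equation with C(m, n). *)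
Lemma padic_binom_approx K (y : Zp) n m :
  dvdr (pi ^+ (K + logn p n`!)) (y - m%:R) ->
  dvdr (pi ^+ K) (padic_binom y n - 'C(m, n)%:R).
Proof.
pose v := logn p n`!.
have prodE k (x : Zp) : dvdr (pi ^+ (k + v)) (x - m%:R) -> forall b,
    n`!%:R * b = \prod_(i < n) (x - i%:R) -> dvdr (pi ^+ k) (b - 'C(m, n)%:R).
  move=> hx b hb; apply: (@Zp_dvd_cancel n`!); first exact: fact_gt0.
  rewrite mulrBr hb -natrM mulnC bin_ffact -prod_sub_ffact.
  apply: dvdr_prod_sub => i _; by rewrite opprB addrA subrK.
move=> hm; apply: (prodE _ _ hm); rewrite {prodE}/padic_binom; case: xgetP => // /=.
suff [b hb] : exists b, n`!%:R * b = \prod_(i < n) (y - i%:R) by move=> /(_ b).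
pose a K := projT1 (cid (Zp_approx (K + v) y)).
have aP k : dvdr (pi ^+ (k + v)) (y - (a k)%:R) by rewrite /a; case: cid.
have prod_approx k : dvdr (pi ^+ (k + v))
    (\prod_(i < n) (y - i%:R) - n`!%:R * 'C(a k, n)%:R).
  rewrite -natrM mulnC bin_ffact -prod_sub_ffact.
  by apply: dvdr_prod_sub => i _; rewrite opprB addrA subrK.
have [k|b hb] := @adic_complete_rate _ _ _ _ hZp (fun k => 'C(a k, n)%:R).
  apply: (@Zp_dvd_cancel n`!); first exact: fact_gt0.
  rewrite mulrBr; apply: (dvdr_sub_trans (y := \prod_(i < n) (y - i%:R))); last first.
    exact: prod_approx.
  by apply/dvdr_sub_sym/(dvdr_expW _ (prod_approx k.+1)); rewrite leq_add2r.
exists b; apply: (adic_eq hZp) => k; apply: dvdr_sub_sym.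
apply: dvdr_sub_trans (dvdr_expW (leq_addr v k) (prod_approx k)) _.
by rewrite -mulrBr; apply: dvdr_mull.
Qed.

(** * One-units in characteristic p: continuity of u^y in the exponent *)

Section PowerInAp.
Variables (F : finFieldType) (P : {poly F}) (Ap : comUnitRingType).
Variables (iA : {rmorphism {poly F} -> Ap}) (hAp : adic_completion P iA).
Hypothesis pAp : p%:R = 0 :> Ap.
Notation Pi := (iA P).

Lemma Zp_to_ApE b m : dvdr pi (b - m%:R) -> Zp_to_Ap p Ap iZ b = m%:R.
Proof.
move=> hm; rewrite /Zp_to_Ap; case: xgetP => [_ _ [z hz ->]|/(_ m%:R) [] /=];
  last first.
  by exists m%:Z => //; rewrite -[m%:Z]natz rmorph_nat.
have := dvdr_sub_trans (dvdr_sub_sym hz) hm.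
rewrite -[m%:R](rmorph_nat iZ) natz -rmorphB -[iZ p]expr1 (adic_dvd hZp) expr1.
move=> [w hw]; have -> : z = m%:Z + p%:Z * w by rewrite -hw addrC subrK.
by rewrite intrD intrM /= -!pmulrn pAp mul0r addr0.
Qed.

(** In characteristic p the left side is (u - 1)^(p^K), and K <= p^K. *)
Lemma expr_one_unit K (u : Ap) : dvdr Pi (u - 1) -> dvdr (Pi ^+ K) (u ^+ (p ^ K) - 1).
Proof.
move=> hu; have pK : [pchar Ap].-nat (p ^ K)%N.
  by rewrite pnatX pnatE // inE pr_p pAp eqxx.
have -> : u ^+ (p ^ K) - 1 = (u - 1) ^+ (p ^ K).
  by rewrite exprDn_pchar // exprNn_pchar // expr1n.
apply: (dvdr_expW _ (dvdr_exp (p ^ K) hu)).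
by apply/ltnW/ltn_expl/prime_gt1.
Qed.

Lemma sum_expr_trunc (x : Ap) (c : nat -> Ap) M N : dvdr Pi x -> (M <= N)%N ->
  dvdr (Pi ^+ M) (\sum_(n < N) c n * x ^+ n - \sum_(n < M) c n * x ^+ n).
Proof.
move=> hx MN; rewrite -!(big_mkord xpredT (fun n => c n * x ^+ n)).
rewrite (big_cat_nat (n := M)) //= addrAC subrr add0r big_seq.
apply: dvdr_sum => i; rewrite mem_index_iota => /andP[Mi _].
exact/dvdr_mull/(dvdr_expW Mi)/dvdr_exp.
Qed.

(** Modulo P^M only the first M terms of the binomial series count, and their coefficients depend
    only on finitely many p-adic digits of y. *)
Lemma unit_pow_approx (u : Ap) (y : Zp) M : dvdr Pi (u - 1) ->
  exists K, forall m, dvdr (pi ^+ K) (y - m%:R) ->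
    dvdr (Pi ^+ M) (unit_pow p P iA iZ u y - u ^+ m).
Proof.
(* The maximum covers the digits lost to n! for n < M; the extra one fixes each binomial coefficient
   modulo p, which is all that [Zp_to_Ap] sees. *)
move=> hu; exists (\max_(n < M) logn p n`!).+1 => m hm.
pose c n := Zp_to_Ap p Ap iZ (padic_binom y n).
have [N|l hl] := @adic_complete_rate _ _ _ _ hAp (fun N => \sum_(n < N) c n * (u - 1)
  ^+ n).
  by rewrite big_ord_recr /= addrAC subrr add0r; apply/dvdr_mull/dvdr_exp.
have -> : unit_pow p P iA iZ u y = l.
  apply: (adic_limE hAp) => k; exists k => n kn; exact: (dvdr_expW kn (hl n)).
apply: dvdr_sub_trans (dvdr_sub_sym (hl M)) _.
(* The finite binomial expansion is padded with M zero terms, so that it has at least M terms and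
   can be truncated like the series. *)
have -> : u ^+ m = \sum_(n < m.+1 + M) 'C(m, n)%:R * (u - 1) ^+ n.
  rewrite big_split_ord /= [X in _ + X]big1 ?addr0; last first.
    by move=> i _; rewrite bin_small ?mul0r // ltnS leq_addr.
  rewrite -{1}[u](subrK 1) addrC exprDn; apply: eq_bigr => i _.
  by rewrite expr1n mul1r mulr_natl.
apply: dvdr_sub_trans _ (dvdr_sub_sym
  (sum_expr_trunc (fun n => 'C(m, n)%:R) hu (leq_addl m.+1 M))).
rewrite -sumrB (eq_bigr (fun=> 0)); first by rewrite big1 //; exact: dvdr0.
move=> i _; rewrite /c (@Zp_to_ApE _ 'C(m, i)) ?subrr //.
rewrite -[iZ p]expr1; apply: padic_binom_approx; apply: dvdr_expW hm.
by rewrite add1n ltnS (leq_bigmax (F := fun i : 'I_M => logn p i`!)).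
Qed.

(** Take naturals m and m' close to y and -y. Then p^K divides m + m', so u^(m + m') is close to 1
    and u^m = u^(m + m') u'^m' is close to u'^m'. *)
Lemma unit_powVN (u u' : Ap) (y : Zp) : u * u' = 1 -> dvdr Pi (u - 1) ->
  unit_pow p P iA iZ u' (- y) = unit_pow p P iA iZ u y.
Proof.
move=> uu' hu; have hu' : dvdr Pi (u' - 1).
  by have := dvdr_mull (- u') hu; rewrite mulrBr mulNr mulrC uu' mulr1 opprK addrC.
apply: (adic_eq hAp) => M.
have [K1 h1] := unit_pow_approx y M hu.
have [K2 h2] := unit_pow_approx (- y) M hu'.
pose K := maxn M (maxn K1 K2).
have [m hm] := Zp_approx K y; have [m' hm'] := Zp_approx K (- y).
have MK : (M <= K)%N by rewrite leq_maxl.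
have K1K : (K1 <= K)%N by rewrite !leq_max leqnn !orbT.
have K2K : (K2 <= K)%N by rewrite !leq_max leqnn !orbT.
apply: dvdr_sub_trans (h2 _ (dvdr_expW K2K hm')) _.
apply: dvdr_sub_trans (dvdr_sub_sym (h1 _ (dvdr_expW K1K hm))).
have /Zp_dvd_nat/dvdnP[t ht] : dvdr (pi ^+ K) ((m + m')%:R : Zp).
  by have := dvdrN (dvdrD hm hm'); rewrite addrACA subrr add0r -opprD opprK natrD.
have -> : u ^+ m = u ^+ (m + m') * u' ^+ m'.
  by rewrite exprD -mulrA -exprMn uu' expr1n mulr1.
rewrite -{1}[u' ^+ m']mul1r -mulrBl; apply/dvdr_mulr/dvdr_sub_sym.
rewrite ht mulnC exprM -(expr1n _ t); apply: dvdr_subX.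
exact/(dvdr_expW MK)/expr_one_unit.
Qed.

End PowerInAp.
End Zp.

(** * Primes of F[theta] and the Teichmueller lift *)

Lemma card_pchar_nat (F : finFieldType) (B : comNzRingType) (f : {rmorphism F -> B}) i :
  [pchar B].-nat (#|F| ^ i)%N.
Proof.
have [p pr_p pF] := finPcharP F.
by rewrite (card_pprimeChar pF) -expnM pnatX pnatE // (rmorph_pchar f) ?orbT.
Qed.

Lemma expf_card_iter (F : finFieldType) i (x : F) : x ^+ (#|F| ^ i) = x.
Proof. by elim: i => [|i IH]; rewrite ?expr1 // expnS exprM expf_card IH. Qed.

Section Residue.
Variables (F : finFieldType).
Notation q := #|F|.
Implicit Types a b Q : {poly F}.

Lemma dvdrE b a : dvdr b a <-> b %| a.
Proof.
split=> [[c ->]|/dvdpP[c ->]]; first exact: dvdp_mulIl.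
by exists c; rewrite mulrC.
Qed.

Lemma prime_deg Q : is_prime Q -> (0 < deg Q)%N.
Proof. by case=> _ [sQ _]; rewrite /deg; case: (size Q) sQ => [|[]]. Qed.

Lemma prime_size Q : is_prime Q -> size Q = (deg Q).+1.
Proof. by move/prime_deg; rewrite /deg; case: (size Q). Qed.

Lemma prime_neq0 Q : is_prime Q -> Q != 0.
Proof. by case=> _ /irredp_neq0. Qed.

Lemma prime_coprimep Q a : is_prime Q -> coprimep Q a = ~~ (Q %| a).
Proof. by case=> _; apply: irreducible_poly_coprime. Qed.

Lemma prime_dvdM Q a b : is_prime Q -> (Q %| a * b) = (Q %| a) || (Q %| b).
Proof.
move=> prQ; have [Qa|nQa] /= := boolP (Q %| a); first by rewrite dvdp_mulr.
by rewrite Gauss_dvdpr // prime_coprimep. Qed.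

Lemma prime_ndvd1 Q : is_prime Q -> ~~ (Q %| 1).
Proof.
move=> prQ; rewrite dvdp1 -[_ == _]negbK; apply/negPn.
by rewrite prime_size // eqSS -lt0n prime_deg.
Qed.

Lemma prime_bezout Q a k : is_prime Q -> ~~ (Q %| a) ->
  exists b, dvdr (Q ^+ k) (a * b - 1).
Proof.
move=> prQ; rewrite -prime_coprimep // coprimep_sym => /(coprimep_expr k).
move=> /Bezout_eq1_coprimepP[[u w] /= e]; exists u.
by exists (- w); rewrite -e; ring.
Qed.

Lemma prime_ndvd_expr P Q n : is_prime P -> is_prime Q -> Q <> P -> ~~ (Q %| P ^+ n).
Proof.
move=> prP prQ QP; rewrite -prime_coprimep // coprimep_expr // prime_coprimep //.
apply/negP => QdP; apply: QP; apply/eqP; rewrite -eqp_monic ?prQ.1 ?prP.1 //.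
have [_ [_ irrP]] := prP; apply: irrP => //.
by rewrite neq_ltn prime_size // ltnS prime_deg // orbT.
Qed.

Lemma prime_split Q a : is_prime Q -> a != 0 ->
  exists k b, a = Q ^+ k * b /\ ~~ (Q %| b).
Proof.
move=> prQ; move: {2}(size a) (leqnn (size a)) => n.
elim: n a => [|n IH] a; first by rewrite leqn0 size_poly_eq0 => /eqP ->; rewrite eqxx.
move=> sa a0; have [/dvdpP[c ac]|nQa] := boolP (Q %| a); last by exists 0, a;
  rewrite mul1r.
have c0 : c != 0 by apply: contraNneq a0 => c0; rewrite ac c0 mul0r.
have [|k [b [cb nb]]] := IH c _ c0.
  move: sa; rewrite ac size_mul // ?prime_neq0 // (prime_size prQ) addnS /=.
  by have := prime_deg prQ; case: (deg Q) => // e _; rewrite addnS ltnS;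
    apply/leq_trans/leq_addr.
by exists k.+1, b; rewrite ac cb exprSr mulrAC.
Qed.

Section Field.
Variables (Q : {poly F}) (prQ : is_prime Q).
Let mi : monic_irreducible_poly Q := (prQ.2, prQ.1).
Notation K := {poly %/ Q with mi}.
Let red (a : {poly F}) : K := in_qpoly Q a.

Let redE a : (red a == 0) = (Q %| a).
Proof.
have hM : Q \is monic := prQ.1.
apply/eqP/idP => [/val_eqP /= | hDp].
  by rewrite -Pdiv.IdomainMonic.modpE (mk_monicE mi).
by apply/val_eqP; rewrite /= -Pdiv.IdomainMonic.modpE (mk_monicE mi).
Qed.

Let redD a b : red (a + b) = red a + red b. Proof. exact: in_qpolyD. Qed.
Let redM a b : red (a * b) = red a * red b. Proof. exact: in_qpolyM. Qed.
Let red0 : red 0 = 0. Proof. exact: in_qpoly0. Qed.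
Let red1 : red 1 = 1. Proof. exact: in_qpoly1. Qed.
Let redN a : red (- a) = - red a. Proof. exact: (linearN (in_qpoly Q)). Qed.
Let redX a k : red (a ^+ k) = red a ^+ k.
Proof. by elim: k => [|k IH]; rewrite ?expr0 ?red1 // !exprS redM IH. Qed.

Lemma prime_dvd_card a : Q %| a ^+ (q ^ deg Q) - a.
Proof. by rewrite -redE redD redN redX -(card_qfpoly mi) expf_card subrr. Qed.

(** The class of theta generates A/Q over F. Were it fixed by x |-> x^(q^i), all q^(deg Q) elements
    of the field A/Q would be roots of a polynomial of degree q^i < q^(deg Q). *)
Lemma prime_ndvd_expX i : (0 < i < deg Q)%N -> ~~ (Q %| 'X ^+ (q ^ i) - 'X).
Proof.
case/andP=> i0 id; apply/negP; rewrite -redE redD redN redX subr_eq0 => /eqP hX.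
have fixes (x : K) : x ^+ (q ^ i) = x.
  have -> : x = red (val x).
    by apply: val_inj; rewrite [RHS]in_qpoly_small ?size_mk_monic.
  elim/poly_ind: (val x : {poly F}) => [|a c IH].
    by rewrite red0 expr0n expn_eq0 gtn_eqF // ltnW // finNzRing_gt1.
  rewrite -redX exprDn_pchar; last by apply: (card_pchar_nat polyC).
  by rewrite exprMn -rmorphXn expf_card_iter /= !redD !redM !redX IH hX.
have q1 := finNzRing_gt1 F.
have qi1 : (1 < q ^ i)%N by rewrite -{1}(expn0 q) ltn_exp2l.
have sz : size ('X^(q ^ i) - 'X : {poly K}) = (q ^ i).+1.
  by rewrite size_polyDl size_polyXn // size_polyN size_polyX.
have := @max_poly_roots _ ('X^(q ^ i) - 'X : {poly K}) (enum K).
rewrite -size_poly_eq0 sz => /(_ isT); rewrite enum_uniq -cardE card_qfpoly.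
have -> : all (root ('X^(q ^ i) - 'X)) (enum K).
  by apply/allP => z _; rewrite rootE !hornerE fixes subrr.
by move=> /(_ isT isT); rewrite ltnS leq_exp2l // leqNgt id.
Qed.

End Field.
End Residue.

(** * Teichmueller representatives and the powers a^s *)

Section Teichmuller.
Variables (F : finFieldType) (hq : (2 < #|F|)%N) (P : {poly F}) (prP : is_prime P).
Variables (Ap : comUnitRingType) (iA : {rmorphism {poly F} -> Ap}).
Hypothesis hAp : adic_completion P iA.
Notation q := #|F|.
Notation Pi := (iA P).
Let N := (q ^ deg P)%N.

Let N1 : (1 < N)%N.
Proof. by rewrite -(expn0 q) ltn_exp2l ?prime_deg // ltnW. Qed.

Let frobB (k : nat) (x y : Ap) : (x - y) ^+ (N ^ k) = x ^+ (N ^ k) - y ^+ (N ^ k).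
Proof.
have h : [pchar Ap].-nat (N ^ k)%N by rewrite /N -expnM; apply:
  (card_pchar_nat (iA \o polyC)).
by rewrite exprDn_pchar // exprNn_pchar.
Qed.

Let frob_small k (x : Ap) : dvdr Pi x -> dvdr (Pi ^+ k) (x ^+ (N ^ k)).
Proof.
by move=> hx; apply: (dvdr_expW _ (dvdr_exp (N ^ k) hx)); apply/ltnW/ltn_expl.
Qed.

Let res_frob (a : Ap) : dvdr Pi (a ^+ N - a).
Proof.
have [u] := adic_dense hAp 1 a; rewrite expr1 => hu.
have h1 := dvdr_subX N hu; apply: dvdr_sub_trans h1 _.
apply: dvdr_sub_trans (dvdr_sub_sym hu).
by rewrite -rmorphXn -rmorphB; apply/dvdr_rmorph/dvdrE/prime_dvd_card.
Qed.

Lemma ndvd_unit (a : Ap) : a \is a GRing.unit -> ~ dvdr Pi a.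
Proof.
move=> ua /(dvdr_mull a^-1); rewrite mulVr // -(rmorph1 iA) -[Pi]expr1.
by rewrite (adic_dvd hAp) expr1 dvdrE; apply/negP/prime_ndvd1.
Qed.

(** The representative is the limit w of a^(N^k), where N is the number of elements of the residue
    field; the sequence converges because a^N = a modulo P and the N-th power map is additive. *)
Lemma teichmuller_exists (a : Ap) : a \is a GRing.unit ->
  exists w, dvdr Pi (a - w) /\ w ^+ N.-1 = 1.
Proof.
move=> ua; have [k|w hw] := @adic_complete_rate _ _ _ _ hAp (fun k => a ^+ (N ^ k)).
  by rewrite expnS exprM -frobB; apply/frob_small/res_frob.
have aw : dvdr Pi (a - w).
  apply: (dvdr_sub_trans (y := a ^+ (N ^ 1))); first by rewrite expn1;
    apply/dvdr_sub_sym/res_frob.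
  by have := hw 1%N; rewrite expr1.
have wN : w ^+ N = w.
  apply: (adic_eq hAp) => k; apply: (dvdr_sub_trans (y := a ^+ (N ^ k.+1))); last first.
    exact: (dvdr_expW (leqnSn k)).
  by rewrite expnSr exprM; apply/dvdr_subX/dvdr_sub_sym.
exists w; split=> //; apply/eqP; rewrite -subr_eq0; apply/eqP/(adic_separated hAp) => k.
(* Passing from w^N = w to w^(N-1) = 1 without dividing by w: w z = 0 and a = w + P c give a z = P c
   z. As a is a unit, z is a multiple of P z, hence divisible by every power of P. *)
set z := w ^+ _ - 1; have [c hc] := aw.
have wz : w * z = 0 by rewrite mulrBr mulr1 -exprS prednK ?wN ?subrr // ltnW.
have zE : z = Pi * (c * a^-1 * z).
  have az : a * z = Pi * c * z by rewrite -hc mulrBl wz subr0.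
  transitivity (a^-1 * (a * z)); first by rewrite mulrA mulVr ?mul1r.
  by rewrite az; ring.
elim: k => [|k [t IH]]; first by exists z; rewrite mul1r.
by rewrite zE IH; exists (c * a^-1 * t); rewrite exprS; ring.
Qed.

(** Uniqueness: two candidates are fixed by x |-> x^(N^k), which is additive, so their difference
    equals its own N^k-th power; being a multiple of P, it vanishes. The alternative w = 0 in the
    definition is excluded since a is a unit. *)
Lemma teichmullerE (a w : Ap) : a \is a GRing.unit -> dvdr Pi (a - w) ->
  w ^+ N.-1 = 1 -> teichmuller P iA a = w.
Proof.
move=> ua aw w1; rewrite /teichmuller; case: xgetP => [w' _ [aw' w1']|/(_ w) []];
  last first.
  by split=> //; right; rewrite subn1.
case: w1' => [w0|]; first by case: (ndvd_unit ua); rewrite -[a]subr0 -w0.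
rewrite subn1 -/N => w1'; have iterN (x : Ap) k : x ^+ N.-1 = 1 -> x ^+ (N ^ k) = x.
  move=> x1; elim: k => [|k IH]; first exact: expr1.
  by rewrite expnS exprM -{1}(ltn_predK N1) exprS x1 mulr1.
apply: (adic_eq hAp) => k; rewrite -(iterN w' k) // -(iterN w k) // -frobB.
by apply/frob_small/(dvdr_sub_trans (dvdr_sub_sym aw') aw).
Qed.

Lemma teichmullerP (a : Ap) : a \is a GRing.unit ->
  [/\ dvdr Pi (a - teichmuller P iA a), teichmuller P iA a ^+ N.-1 = 1
    & teichmuller P iA a \is a GRing.unit].
Proof.
move=> ua; have [w [aw w1]] := teichmuller_exists ua.
rewrite (teichmullerE ua aw w1); split=> //.
by rewrite -(@unitrX_pos _ _ N.-1) ?w1 ?unitr1 // -subn1 subn_gt0.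
Qed.

Lemma teichmullerV (a : Ap) : a \is a GRing.unit ->
  teichmuller P iA a^-1 = (teichmuller P iA a)^-1.
Proof.
move=> ua; have [aw w1 uw] := teichmullerP ua.
apply: teichmullerE; rewrite ?unitrV //; last by rewrite exprVn w1 invr1.
set w := teichmuller _ _ _ in aw w1 uw *.
have -> : a^-1 - w^-1 = - (a^-1 * w^-1) * (a - w).
  by rewrite mulNr mulrBr mulrAC mulVr // mul1r -mulrA mulVr // mulr1 opprB.
exact: dvdr_mull.
Qed.

Lemma one_unitP (a : Ap) : a \is a GRing.unit -> dvdr Pi (one_unit P iA a - 1).
Proof.
move=> ua; have [aw _ uw] := teichmullerP ua.
by rewrite /one_unit -(divrr uw) -mulrBl; apply: dvdr_mulr.
Qed.

Lemma adic_powVN p (pr_p : prime p) (pAp : p%:R = 0 :> Ap) (Zp : comNzRingType)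
    (iZ : {rmorphism int -> Zp}) (hZp : adic_completion p%:Z iZ)
    (a : Ap) (s : Zp * 'Z_(q ^ deg P - 1)) :
  a \is a GRing.unit -> adic_pow p iA iZ a^-1 (- s) = adic_pow p iA iZ a s.
Proof.
case: s => y i ua; rewrite /adic_pow /= teichmullerV //.
have [_ w1 uw] := teichmullerP ua; congr (_ * _); last first.
  apply: (unit_powVN pr_p hZp hAp pAp); last exact: one_unitP.
  by rewrite /one_unit teichmullerV // invrK mulrACA divrr // mulVr // mulr1.
(* ['Z_m] is Z/m only for m > 1; here q >= 3 enters. *)
have M1 : (1 < q ^ deg P - 1)%N.
  rewrite ltn_subRL addn1; apply: (leq_trans hq).
  by rewrite -{1}(expn1 q) leq_exp2l ?prime_deg // ltnW.
(* The exponents are the natural representatives of i and -i, whose sum is a multiple of q^d - 1;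
   hence w to that sum is 1. *)
apply: (mulIr (unitrX (- i) uw)); rewrite exprVn mulVr ?unitrX // -exprD.
have : (i + - i)%R == 0 :> 'I_(Zp_trunc (q ^ deg P - 1)).+2 by rewrite subrr.
rewrite -val_eqE => /dvdnP[t /= ->].
by rewrite mulnC exprM Zp_cast // subn1 w1 expr1n.
Qed.

End Teichmuller.

(** * The Carlitz module and its torsion *)

Section Frobenius.
Variables (F : finFieldType) (B : comNzRingType) (f : {rmorphism F -> B}).
Notation q := #|F|.
Implicit Types x y : B.

Lemma frobD i x y : (x + y) ^+ (q ^ i) = x ^+ (q ^ i) + y ^+ (q ^ i).
Proof. by apply: exprDn_pchar; apply: (card_pchar_nat f). Qed.

Lemma frob0 i : 0 ^+ (q ^ i) = 0 :> B.
Proof. by rewrite expr0n expn_eq0 gtn_eqF // ltnW // finNzRing_gt1. Qed.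

Lemma frobB i x y : (x - y) ^+ (q ^ i) = x ^+ (q ^ i) - y ^+ (q ^ i).
Proof. by rewrite frobD exprNn_pchar //; apply: (card_pchar_nat f). Qed.

Lemma frob_sum i (I : Type) (s : seq I) (Q : pred I) (h : I -> B) :
  (\sum_(k <- s | Q k) h k) ^+ (q ^ i) = \sum_(k <- s | Q k) h k ^+ (q ^ i).
Proof. exact: (big_morph (fun x => x ^+ (q ^ i)) (frobD i) (frob0 i)). Qed.

End Frobenius.

Section CarlitzCoef.
Variable F : finFieldType.
Notation A := {poly F}.
Notation q := #|F|.
Implicit Types (a b : A) (g : {poly A}).

Let q_gt1 : (1 < q)%N := finNzRing_gt1 F.

Lemma coef_twmul_theta g k :
  (twmul ('X%:P + 'X) g)`_k = 'X * g`_k + (if k is k'.+1 then g`_k' ^+ q else 0).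
Proof.
rewrite /twmul; have -> : size ('X%:P + 'X : {poly A}) = 2.
  by rewrite addrC size_XaddC.
rewrite !big_ord_recl big_ord0 addr0 /= /bump /= expn0 expn1.
have -> : ('X%:P + 'X : {poly A})`_0 = 'X by rewrite coefD coefC coefX addr0.
have -> : ('X%:P + 'X : {poly A})`_1 = 1 by rewrite coefD coefC coefX add0r.
rewrite coefD !coef_sum; congr (_ + _).
  under eq_bigr => j _ do rewrite coefZ coefXn add0n expr1.
  have [kg|gk] := ltnP k (size g).
    rewrite (bigD1 (Ordinal kg)) //= eqxx mulr1 big1 ?addr0 // => j jk.
    by rewrite eq_sym (_ : (_ == _) = false) ?mulr0 //; apply/negbTE.
  rewrite big1 => [|j _]; first by rewrite nth_default // mulr0.
  by rewrite gtn_eqF ?mulr0 // (leq_trans (ltn_ord j)).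
under eq_bigr => j _ do rewrite coefZ coefXn add1n mul1r.
case: k => [|k]; first by rewrite big1 // => j _; rewrite mulr0.
have [kg|gk] := ltnP k (size g).
  rewrite (bigD1 (Ordinal kg)) //= eqxx mulr1 big1 ?addr0 // => j jk.
  by rewrite eqSS eq_sym (_ : (_ == _) = false) ?mulr0 //; apply/negbTE.
rewrite big1 => [|j _]; first by rewrite nth_default // -[q]expn1 frob0.
by rewrite eqSS gtn_eqF ?mulr0 // (leq_trans (ltn_ord j)).
Qed.

Let W k : {poly A} := iter k (twmul ('X%:P + 'X)) 1.

Lemma carlitz_widen N a : (size a <= N)%N ->
  carlitz a = \sum_(k < N) (a`_k)%:P *: W k.
Proof.
move=> aN; rewrite /carlitz -/W -!(big_mkord xpredT (fun k => (a`_k)%:P *: W k)).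
rewrite (big_cat_nat (n := size a) (p := N)) //= [X in _ = _ + X]big_seq [X in _ = _
  + X]big1 ?addr0 //.
by move=> k; rewrite mem_index_iota => /andP[ak _]; rewrite nth_default // scale0r.
Qed.

Lemma carlitzD a b : carlitz (a + b) = carlitz a + carlitz b.
Proof.
rewrite (carlitz_widen (size_polyD a b)) (carlitz_widen (leq_maxl (size a) (size b))).
rewrite (carlitz_widen (leq_maxr (size a) (size b))) -big_split /=.
by apply: eq_bigr => k _; rewrite coefD polyCD scalerDl.
Qed.

Lemma carlitzZ c a : carlitz (c *: a) = c%:P *: carlitz a.
Proof.
rewrite (carlitz_widen (size_scale_leq c a)) (carlitz_widen (leqnn (size a))).
by rewrite scaler_sumr; apply: eq_bigr => k _; rewrite coefZ polyCM scalerA.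
Qed.

Lemma carlitz1 : carlitz 1 = 1 :> {poly A}.
Proof.
by rewrite /carlitz size_poly1 big_ord_recl big_ord0 addr0 coefC scale1r.
Qed.

Lemma carlitz0 : carlitz 0 = 0 :> {poly A}.
Proof. by rewrite /carlitz size_poly0 big_ord0. Qed.

Lemma carlitzN a : carlitz (- a) = - carlitz a.
Proof. by apply/eqP; rewrite -addr_eq0 -carlitzD addNr carlitz0. Qed.

Lemma carlitzB a b : carlitz (a - b) = carlitz a - carlitz b.
Proof. by rewrite carlitzD carlitzN. Qed.

(** This is Phi_(a theta) = (theta + tau) Phi_a read coefficientwise; the constants of F pass
    through tau because c^q = c. The properties of the coefficients below follow from this
    recurrence by induction on a. *)
Lemma coef_carlitzMX a i : (carlitz (a * 'X))`_i =
  'X * (carlitz a)`_i + (if i is i'.+1 then (carlitz a)`_i' ^+ q else 0).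
Proof.
have -> : carlitz (a * 'X) = \sum_(k < size a) (a`_k)%:P *: W k.+1.
  rewrite (@carlitz_widen (size a).+1); last first.
    by have := size_polyMleq a 'X; rewrite size_polyX addn2.
  by rewrite big_ord_recl coefMX scale0r add0r; apply: eq_bigr => k _; rewrite coefMX.
rewrite coef_sum (eq_bigr (fun k : 'I_(size a) => 'X * ((a`_k)%:P * (W k)`_i) +
    (if i is i'.+1 then ((a`_k)%:P * (W k)`_i') ^+ q else 0))); last first.
  move=> k _; rewrite coefZ /W iterS coef_twmul_theta mulrDr mulrCA; congr (_ + _).
  by case: i => [|i]; rewrite ?mulr0 // exprMn -rmorphXn /= expf_card.
rewrite big_split -mulr_sumr /carlitz -/W coef_sum /=; congr (_ * _ + _).
  by apply: eq_bigr => k _; rewrite coefZ.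
case: i => [|i]; first by rewrite big1.
rewrite coef_sum -{2}[q]expn1 (frob_sum (@polyC F)).
by apply: eq_bigr => k _; rewrite coefZ expn1.
Qed.

Lemma coef_carlitz_cons a c i : (carlitz (a * 'X + c%:P))`_i =
  'X * (carlitz a)`_i + (if i is i'.+1 then (carlitz a)`_i' ^+ q else 0)
  + c%:P * (i == 0)%:R.
Proof.
by rewrite carlitzD coefD coef_carlitzMX -alg_polyC carlitzZ carlitz1 coefZ coef1
  alg_polyC.
Qed.

Lemma coef0_carlitz a : (carlitz a)`_0 = a.
Proof.
elim/poly_ind: a => [|a c IH]; first by rewrite carlitz0 coef0.
by rewrite coef_carlitz_cons IH addr0 mulr1 mulrC.
Qed.

Lemma coef_carlitz_gt a i : (size a <= i)%N -> (carlitz a)`_i = 0.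
Proof.
elim/poly_ind: a i => [|a c IH] i; first by rewrite carlitz0 coef0.
rewrite size_MXaddC coef_carlitz_cons; case: ifP => [/andP[/eqP -> /eqP ->] _|_].
  by rewrite carlitz0 mul0r; case: i => [|i];
    rewrite !coef0 mulr0 ?addr0 // -[q]expn1 frob0 !addr0.
case: i => [//|i] ai; rewrite (IH i.+1 (ltnW ai)) (IH i ai) -[q]expn1 frob0.
by rewrite !mulr0 !addr0.
Qed.

Lemma coef_carlitz_lead a : (carlitz a)`_(deg a) = (lead_coef a)%:P.
Proof.
elim/poly_ind: a => [|a c IH]; first by rewrite carlitz0 coef0 lead_coef0.
rewrite /deg size_MXaddC coef_carlitz_cons.
have [->|a0] /= := eqVneq a 0.
  rewrite carlitz0 mul0r add0r lead_coefC size_poly0 (_ :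
    (if _ then _ else _).-1 = 0%N).
    by rewrite coef0 mulr0 !add0r mulr1.
  by case: ifP.
rewrite lead_coefDl; last first.
  rewrite size_mulX // (leq_ltn_trans (size_polyC_leq1 _)) // ltnS.
  by rewrite lt0n size_poly_eq0.
rewrite lead_coefMX coef_carlitz_gt ?leqnn // mulr0 add0r.
have : size a != 0 by rewrite size_poly_eq0.
rewrite -lt0n /deg in IH *; case: (size a) IH => //= n -> _.
by rewrite mulr0 addr0 -rmorphXn /= expf_card.
Qed.

Lemma size_carlitz a : size (carlitz a) = size a.
Proof.
apply/eqP; rewrite eqn_leq; apply/andP; split.
  by apply/leq_sizeP => i; apply: coef_carlitz_gt.
have [->|a0] := eqVneq a 0; first by rewrite size_poly0.
rewrite -(ltn_predK (_ : (0 < size a)%N)) ?lt0n ?size_poly_eq0 //.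
rewrite ltnNge; apply/negP => /leq_sizeP/(_ _ (leqnn _))/eqP.
by rewrite coef_carlitz_lead polyC_eq0 lead_coef_eq0 (negPf a0).
Qed.

(** The right side is the coefficient of tau^i in the twisted product Phi_a Phi_b. *)
Lemma coef_carlitzM a b i : (carlitz (a * b))`_i =
  \sum_(k < i.+1) (carlitz a)`_k * (carlitz b)`_(i - k) ^+ (q ^ k).
Proof.
elim/poly_ind: a i => [|a c IH] i.
  by rewrite mul0r carlitz0 coef0 big1 // => k _; rewrite coef0 mul0r.
under eq_bigr => k _ do rewrite coef_carlitz_cons mulrDl mulrDl.
rewrite 2!big_split /= [X in _ = _ + X](bigD1 ord0) //= [X in _ = _ + (_ + X)]big1;
  last first.
  by move=> [[|k] ki] //= _; rewrite mulr0 mul0r.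
rewrite addr0 mulr1 subn0 expn0 expr1 mulrDl mulrAC carlitzD coefD coef_carlitzMX.
rewrite mul_polyC carlitzZ coefZ; congr (_ + _ + _).
  by rewrite IH mulr_sumr; apply: eq_bigr => k _; rewrite mulrA.
rewrite big_ord_recl mul0r add0r; case: i => [|i]; first by rewrite big_ord0.
rewrite IH; apply: etrans (frob_sum (@polyC F) 1 _ _ _) _; apply: eq_bigr => k _ /=.
by rewrite exprMn expn1 -exprM -expnSr.
Qed.

(** Together with the leading coefficient 1, this is Phi_Q = tau^(deg Q) modulo Q. *)
Lemma prime_dvd_coef_carlitz (Q : A) i : is_prime Q -> (i < deg Q)%N ->
  Q %| (carlitz Q)`_i.
Proof.
move=> prQ; elim: i => [|i IH] iQ; first by rewrite coef0_carlitz dvdpp.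
(* Comparing the two expansions of Phi_Q Phi_theta = Phi_theta Phi_Q gives
   (theta^(q^(i+1)) - theta) c_(i+1) = c_i^q - c_i. *)
have := coef_carlitzM Q 'X i.+1; rewrite coef_carlitzMX big_ord_recr big_ord_recr /=.
have cX k : (carlitz 'X : {poly A})`_k = if k is k'.+1 then (k' == 0)%:R else 'X.
  rewrite -{1}['X]mul1r coef_carlitzMX carlitz1 coef1; case: k => [|k] /=.
    by rewrite mulr1 addr0.
  by rewrite coef1 mulr0 add0r; case: k => [|k]; rewrite ?expr1n // -[q]expn1 frob0.
rewrite subnn subSn // subnn !cX big1 => [|k _]; last first.
  by rewrite subSn ?(ltnW (ltn_ord k)) // cX subn_eq0 leqNgt ltn_ord frob0 mulr0.
rewrite add0r expr1n mulr1 => /eqP; rewrite -subr_eq0 => /eqP e.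
have : Q %| (carlitz Q)`_i.+1 * ('X ^+ (q ^ i.+1) - 'X).
  rewrite (_ : _ * _ = (carlitz Q)`_i ^+ q - (carlitz Q)`_i); last first.
    by apply/eqP; rewrite -subr_eq0 -oppr_eq0 -[X in _ == X]e; apply/eqP; ring.
  have h := IH (ltnW iQ); apply: dvdp_sub => //.
  by rewrite -(prednK (ltnW q_gt1)) exprS dvdp_mulr.
by rewrite prime_dvdM // (negPf (prime_ndvd_expX _ _)) ?orbF.
Qed.

(** In a product of m factors Phi_Q, a contribution to tau^i uses a positive power of tau from at
    most i factors; each of the others gives its constant coefficient Q. This yields the Q-adic
    continuity of the coefficients of Phi_a in a. *)
Lemma dvd_coef_carlitz_exp (Q : A) m b i :
  dvdr (Q ^+ (m - i)) ((carlitz (Q ^+ m * b))`_i).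
Proof.
elim: m i => [|m IH] i; first by rewrite sub0n; exists ((carlitz (Q ^+ 0 * b))`_i);
  rewrite [RHS]mul1r.
rewrite exprS -mulrA coef_carlitzM; apply: dvdr_sum => -[[|k] ki] _ /=.
  rewrite coef0_carlitz subn0 expr1; apply: (dvdr_expW (n := (m - i).+1)).
    by rewrite leq_subLR addnS -[leqLHS]add1n addnC addn1 ltnS -leq_subLR.
  by rewrite exprS; apply: dvdr_mul; [exact: dvdrr | exact: IH].
apply: dvdr_mull; have /dvdr_trans :
  dvdr (Q ^+ (m.+1 - i)) ((carlitz (Q ^+ m * b))`_(i - k.+1)).
  apply: (dvdr_expW _ (IH _)).
  lia.
apply; have q0 : (0 < q ^ k.+1)%N by rewrite expn_gt0 ltnW.
by have := dvdr_exp2 ((carlitz (Q ^+ m * b))`_(i - k.+1)) q0; rewrite expr1.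
Qed.

End CarlitzCoef.

HB.instance Definition _ (F : finFieldType) (E : fieldType)
    (iota : {rmorphism {fraction {poly F}} -> E}) :=
  GRing.RMorphism.copy (ofA iota) (iota \o @tofrac _).

Section CarlitzPoly.
Variable F : finFieldType.
Notation A := {poly F}.
Notation q := #|F|.
Implicit Types a b : A.

Let q_gt1 : (1 < q)%N := finNzRing_gt1 F.

Definition carlitz_poly a : {poly A} := \sum_(i < size a) (carlitz a)`_i *: 'X^(q ^ i).

(** Only the linear term survives, since q^i = 0 in characteristic p for i > 0. A constant
    derivative serves both for separability and for unramifiedness away from a. *)
Lemma deriv_carlitz_poly a : (carlitz_poly a)^`() = a%:P.
Proof.
rewrite /carlitz_poly; have [->|a0] := eqVneq a 0.
  by rewrite size_poly0 big_ord0 derivC.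
rewrite (raddf_sum (@deriv _)) -(ltn_predK (_ :
  (0 < size a)%N)) ?lt0n ?size_poly_eq0 //.
rewrite big_ord_recl /= expn0 expr1 derivZ derivX alg_polyC coef0_carlitz.
rewrite big1 ?addr0 // => i _; rewrite /= derivZ derivXn -scaler_nat.
have [p pr_p pF] := finPcharP F.
rewrite (_ : (q ^ _)%:R = 0) ?scale0r ?scaler0 //.
apply/eqP; rewrite -(dvdn_pcharf (rmorph_pchar (@polyC F) pF)) /bump /= add1n.
rewrite (card_pprimeChar pF) -expnM dvdn_exp // muln_gt0 andbT lt0n.
by apply: contraTneq q_gt1 => e; rewrite (card_pprimeChar pF) e.
Qed.

Lemma carlitz_poly_monic a : a \is monic ->
  carlitz_poly a \is monic /\ size (carlitz_poly a) = (q ^ deg a).+1.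
Proof.
move=> am; have a0 := monic_neq0 am; have am' := monicP am.
have : carlitz_poly a = 'X^(q ^ deg a) + \sum_(i < deg a) (carlitz a)`_i *: 'X^(q ^ i).
  rewrite /carlitz_poly -(ltn_predK (_ : (0 < size a)%N)) ?lt0n ?size_poly_eq0 //.
  by rewrite big_ord_recr /= coef_carlitz_lead am' scale1r addrC.
set R := \sum_(i < _) _ => ->; have sR : (size R < size ('X^(q ^ deg a) : {poly A}))%N.
  rewrite size_polyXn ltnS; apply: leq_trans (size_sum _ _ _) _;
    apply/bigmax_leqP => i _.
  by apply: leq_trans (size_scale_leq _ _) _; rewrite size_polyXn ltn_exp2l.
by rewrite size_polyDl // size_polyXn monicE lead_coefDl // lead_coefXn.
Qed.

End CarlitzPoly.

Section Evaluation.
Variables (F : finFieldType) (E : fieldType) (iota :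
  {rmorphism {fraction {poly F}} -> E}).
Notation A := {poly F}.
Notation q := #|F|.
Notation ev := (carlitz_eval iota).
Implicit Types (a b : A) (x y : E).

Lemma ofA_inj : injective (ofA iota).
Proof. by move=> a b /fmorph_inj/eqP; rewrite tofrac_eq => /eqP. Qed.

Lemma ofA_eq0 a : (ofA iota a == 0) = (a == 0).
Proof. by rewrite -(rmorph0 (ofA iota)) (inj_eq ofA_inj). Qed.

Let frobED := frobD (ofA iota \o polyC).

Lemma carlitz_evalE N a x : (size a <= N)%N ->
  ev a x = \sum_(i < N) ofA iota (carlitz a)`_i * x ^+ (q ^ i).
Proof.
move=> aN; rewrite /carlitz_eval size_carlitz.
rewrite -!(big_mkord xpredT (fun i => ofA iota (carlitz a)`_i * x ^+ (q ^ i))).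
rewrite (big_cat_nat (n := size a) (p := N)) //= [X in _ = _ + X]big_seq.
rewrite [X in _ = _ + X]big1 ?addr0 // => i; rewrite mem_index_iota => /andP[ai _].
by rewrite coef_carlitz_gt // rmorph0 mul0r.
Qed.

Lemma carlitz_eval_poly a x : ev a x = (map_poly (ofA iota) (carlitz_poly a)).[x].
Proof.
rewrite (carlitz_evalE _ (leqnn _)) /carlitz_poly rmorph_sum horner_sum.
by apply: eq_bigr => i _; rewrite /= linearZ /= rmorphXn /= map_polyX !hornerE.
Qed.

Lemma carlitz_evalDr a x y : ev a (x + y) = ev a x + ev a y.
Proof.
by rewrite /carlitz_eval -big_split; apply: eq_bigr => i _ /=; rewrite frobED mulrDr.
Qed.

Lemma carlitz_evalr0 a : ev a 0 = 0.
Proof. by apply: (addrI (ev a 0)); rewrite -carlitz_evalDr !addr0. Qed.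

Lemma carlitz_evalBr a x y : ev a (x - y) = ev a x - ev a y.
Proof. by apply/eqP; rewrite eq_sym subr_eq -carlitz_evalDr subrK. Qed.

Lemma carlitz_evalDl a b x : ev (a + b) x = ev a x + ev b x.
Proof.
rewrite (carlitz_evalE _ (size_polyD a b)) (carlitz_evalE _ (leq_maxl (size a) (size
  b))).
rewrite (carlitz_evalE _ (leq_maxr (size a) (size b))) -big_split.
by apply: eq_bigr => i _; rewrite carlitzD coefD rmorphD mulrDl.
Qed.

Lemma carlitz_eval0 x : ev 0 x = 0.
Proof. by rewrite (carlitz_evalE (N := 0)) ?size_poly0 // big_ord0. Qed.

Lemma carlitz_evalBl a b x : ev (a - b) x = ev a x - ev b x.
Proof. by apply/eqP; rewrite eq_sym subr_eq -carlitz_evalDl subrK. Qed.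

Lemma carlitz_evalZ c a x : ev (c *: a) x = ofA iota c%:P * ev a x.
Proof.
rewrite (carlitz_evalE _ (size_scale_leq c a)) (carlitz_evalE _ (leqnn (size a)))
  mulr_sumr.
by apply: eq_bigr => i _; rewrite carlitzZ coefZ rmorphM mulrA.
Qed.

Lemma carlitz_eval1 x : ev 1 x = x.
Proof.
rewrite (carlitz_evalE (N := 1)) ?size_poly1 // big_ord_recl big_ord0 carlitz1 coef1.
by rewrite rmorph1 mul1r addr0.
Qed.

Lemma carlitz_evalMX a x : ev (a * 'X) x = ofA iota 'X * ev a x + ev a x ^+ q.
Proof.
rewrite (carlitz_evalE (N := (size a).+1)); last first.
  by have := size_polyMleq a 'X; rewrite size_polyX addn2.
under eq_bigr => i _ do rewrite coef_carlitzMX rmorphD mulrDl.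
rewrite big_split (carlitz_evalE _ (leqnSn (size a))) mulr_sumr; congr (_ + _).
  by apply: eq_bigr => i _; rewrite rmorphM mulrA.
rewrite big_ord_recl /= rmorph0 mul0r add0r.
apply: esym; apply: etrans (frob_sum (ofA iota \o polyC) 1 _ _ _) _.
rewrite big_ord_recr /= coef_carlitz_gt // rmorph0 mul0r frob0 addr0.
by apply: eq_bigr => i _; rewrite expn1 exprMn -exprM -expnSr rmorphXn.
Qed.

Lemma carlitz_evalM a b x : ev (a * b) x = ev a (ev b x).
Proof.
elim/poly_ind: a => [|a c IH]; first by rewrite mul0r !carlitz_eval0.
rewrite mulrDl mulrAC mul_polyC !carlitz_evalDl !carlitz_evalMX IH carlitz_evalZ.
by rewrite -[c%:P]alg_polyC carlitz_evalZ carlitz_eval1 alg_polyC.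
Qed.

Lemma carlitz_eval_comm a b x : ev a (ev b x) = ev b (ev a x).
Proof. by rewrite -!carlitz_evalM mulrC. Qed.

Lemma torsion_eval a b x : torsion iota a x -> torsion iota a (ev b x).
Proof. by rewrite /torsion /= => ax; rewrite carlitz_eval_comm ax carlitz_evalr0. Qed.

Lemma torsion_mul a b x : torsion iota a x -> torsion iota (b * a) x.
Proof. by rewrite /torsion /= => ax; rewrite carlitz_evalM ax carlitz_evalr0. Qed.

Lemma torsion_exp (Q : A) m n x : (m <= n)%N ->
  torsion iota (Q ^+ m) x -> torsion iota (Q ^+ n) x.
Proof. by move=> mn; rewrite -(subnK mn) exprD; apply: torsion_mul. Qed.

Lemma torsionB a x y : torsion iota a x -> torsion iota a y -> torsion iota a (x - y).
Proof. by rewrite /torsion /= carlitz_evalBr => -> ->; rewrite subrr. Qed.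

Lemma carlitz_eval_congr a b c x : torsion iota c x -> dvdr c (a - b) ->
  ev a x = ev b x.
Proof.
move=> cx [d e]; apply/eqP; rewrite -subr_eq0 -carlitz_evalBl e mulrC.
by rewrite carlitz_evalM cx carlitz_evalr0.
Qed.

End Evaluation.

(** * Phi[P^n] is a cyclic module isomorphic to A/P^n *)

Section Torsion.
Variables (F : finFieldType) (E : closedFieldType).
Variables (iota : {rmorphism {fraction {poly F}} -> E}).
Notation A := {poly F}.
Notation q := #|F|.
Notation ev := (carlitz_eval iota).

Let q_gt1 : (1 < q)%N := finNzRing_gt1 F.

Lemma separable_carlitz_poly (a : A) : a != 0 ->
  separable_poly (map_poly (ofA iota) (carlitz_poly a)).
Proof.
move=> a0; rewrite unlock deriv_map deriv_carlitz_poly map_polyC /=.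
by rewrite -alg_polyC coprimepZr ?ofA_eq0 // coprimep1.
Qed.

Lemma torsion_seq (a : A) : a \is monic ->
  exists s : seq E, [/\ uniq s, size s = (q ^ deg a)%N
    & forall x, torsion iota a x <-> x \in s].
Proof.
move=> am; have [mp sp] := carlitz_poly_monic am.
set p := map_poly (ofA iota) (carlitz_poly a).
have mp' : p \is monic by apply: monic_map.
have [s hs] := closed_field_poly_normal p.
rewrite (monicP mp') scale1r in hs; exists s; split.
- by rewrite -separable_prod_XsubC -hs separable_carlitz_poly // monic_neq0.
- have := size_map_inj_poly (@ofA_inj _ _ iota) (rmorph0 _) (carlitz_poly a).
  by rewrite -/p hs size_prod_XsubC sp => -[].
- move=> x; rewrite -root_prod_XsubC -hs rootE -carlitz_eval_poly.
  by rewrite /torsion /=; split=> [->|/eqP].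
Qed.

Variables (P : A) (prP : is_prime P).

(** For n > 0, counting gives a point l of Phi[P^n] outside Phi[P^(n-1)]. If P^k b kills l with b
    prime to P, then so does P^k, since b is invertible modulo P^n; hence k >= n. The multiples of l
    by the q^(deg P^n) residues modulo P^n are therefore distinct and exhaust Phi[P^n]. *)
Lemma torsion_generator n : exists l, [/\ torsion iota (P ^+ n) l,
  forall a, ev a l = 0 -> dvdr (P ^+ n) a
  & forall x, torsion iota (P ^+ n) x -> exists a, x = ev a l].
Proof.
case: n => [|n].
  exists 0; split; first exact: carlitz_evalr0.
    by move=> a _; exists a; rewrite expr0 mul1r.
  by move=> x; rewrite /torsion /= carlitz_eval1 => ->; exists 0; rewrite carlitz_eval0.
have mPn k : P ^+ k \is monic by rewrite monic_exp // prP.1.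
have degPn k : deg (P ^+ k) = (deg P * k)%N.
  by rewrite /deg size_exp.
have [s [us ss sP]] := torsion_seq (mPn n.+1).
have [t [ut st tP]] := torsion_seq (mPn n).
have [l ls lt] : exists2 l, l \in s & l \notin t.
  apply: contrapT => h; have : (size s <= size t)%N.
    by apply: uniq_leq_size => // x xs; apply: contrapT => /negP xt; apply: h; exists x.
  by rewrite ss st !degPn leq_exp2l // leq_pmul2l ?prime_deg // ltnn.
have ann a : ev a l = 0 -> dvdr (P ^+ n.+1) a.
  have [->|a0] := eqVneq a 0; first by move=> _; exact: dvdr0.
  have [k [b [-> nb]]] := prime_split prP a0.
  have [b' bb'] := prime_bezout n.+1 prP nb => abl.
  have [nk|kn] := ltnP n k; first exact/dvdr_mulr/dvdr_exp2.
  case/negP: lt; apply/tP/(torsion_exp kn); rewrite /torsion /=.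
  rewrite (carlitz_eval_congr (b := b' * (P ^+ k * b)) ((sP _).2 ls)).
    by rewrite carlitz_evalM abl carlitz_evalr0.
  apply: dvdr_sub_sym; rewrite -{2}[P ^+ k]mulr1 mulrCA -mulrBr [b' * b]mulrC.
  exact: dvdr_mull.
have {}ls : torsion iota (P ^+ n.+1) l by apply/sP.
exists l; split=> //.
(* Row vectors of length m encode the polynomials of degree less than m, the representatives modulo
   P^(n+1). *)
pose m := (deg P * n.+1)%N.
pose u := [seq ev (rVpoly v) l | v : 'rV[F]_m].
have uu : uniq u.
  rewrite map_inj_uniq ?enum_uniq // => v w /eqP.
  rewrite -subr_eq0 -carlitz_evalBl -linearB /= => /eqP/ann/dvdrE/dvdp_leq h.
  apply/eqP; rewrite -subr_eq0 -[v - w]rVpolyK; apply/eqP.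
  have [->|/h] := eqVneq (rVpoly (v - w)) 0; first by rewrite linear0.
  rewrite leqNgt => /negP[]; apply: leq_ltn_trans (size_poly _ _) _.
  by rewrite /m -degPn /deg prednK // lt0n size_poly_eq0 monic_neq0.
have [||_ us'] := uniq_min_size uu (s2 := s).
- by move=> _ /mapP[v _ ->]; apply/sP/torsion_eval.
- by rewrite ss size_map -cardE card_mx mul1n degPn.
- by move=> x /sP; rewrite -us' => /mapP[v _ ->]; exists (rVpoly v).
Qed.

End Torsion.

(** * Fields generated by torsion points *)

Section SimpleExtension.
Variables (K : fieldType) (E : closedFieldType) (iota : {rmorphism K -> E}).

(** For l algebraic, K[l] is already the field K(l), so its elements can be handled as polynomial
    values. *)
Definition simple_ext (l : E) : set E := [set x | exists c :
  {poly K}, x = (map_poly iota c).[l]].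

Variables (l : E) (f : {poly K}).
Hypotheses (sep_f : separable_poly f) (fl0 : root (map_poly iota f) l).
Hypothesis split_f : forall y, root (map_poly iota f) y -> simple_ext l y.

(** K(l) is the splitting field of the separable polynomial f, hence separable and normal: the
    minimal polynomial of each of its elements is separable and splits in it. *)
Lemma simple_ext_galois : intermediate iota (simple_ext l) /\ galois_ext iota
  (simple_ext l).
Proof.
have f0 : f != 0 by apply: contraTneq sep_f => ->;
  rewrite unlock deriv0 coprimep0 -size_poly_eq1 size_poly0.
have [||p [/monic_neq0 p0 pz0 irr_p]] := @minPoly_decidable_closure K E iota l.
- by move=> y; apply: pselect.
- by apply/integral_algebraic; exists f.
(* [L] is an abstract copy of K(l), to which the theory of finite extensions applies; the embedding
   [h] has image [simple_ext l] and carries the conclusions back to E. *)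
pose L : fieldExtType K := SubFieldExtType pz0 irr_p.
pose h : {rmorphism L -> E} := @subfx_inj _ _ iota l p.
pose r : L := subfx_root iota l p.
have hr : h r = l by apply: subfx_inj_root.
have hbase a : h a%:A = iota a by apply: subfx_inj_base.
have hpoly (c : {poly K}) : map_poly h (map_poly (in_alg L) c) = map_poly iota c.
  by rewrite -map_poly_comp; apply: eq_map_poly.
have Lpoly (u : L) : exists c : {poly K}, u = (map_poly (in_alg L) c).[r].
  by have [c ->] := subfxEroot pz0 p0 u; exists c.
have memL x : simple_ext l x <-> exists u, x = h u.
  split=> [[c ->]|[u ->]]; last first.
    by have [c ->] := Lpoly u; exists c; rewrite -horner_map /= hr hpoly.
  by exists (map_poly (in_alg L) c).[r]; rewrite -horner_map /= hr hpoly.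
split.
  split=> [a|x y|x y|x].
  - by apply/memL; exists a%:A; rewrite hbase.
  - by move=> /memL[u ->] /memL[w ->]; apply/memL; exists (u - w); rewrite rmorphB.
  - by move=> /memL[u ->] /memL[w ->]; apply/memL; exists (u * w); rewrite rmorphM.
  - by move=> /memL[u ->]; apply/memL; exists u^-1; rewrite fmorphV.
pose fL := map_poly (in_alg L) f.
have root_fL : root fL r by rewrite -(fmorph_root h) /= hr /fL hpoly.
have fL1 : fL \is a polyOver 1%VS by apply/polyOver1P; exists f.
have sep_r : separable_element 1 r.
  by apply/separable_elementP; exists fL; split=> //; rewrite separable_map.
have genr : <<1; r>>%VS = fullv.
  apply/vspaceP => u; rewrite memvf; apply/Fadjoin1_polyP.
  by have [c ->] := Lpoly u; exists c.
have splitL : splitting_field_axiom L.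
  exists fL => //; have [zs hzs] := closed_field_poly_normal (map_poly iota f).
  have lf0 : lead_coef (map_poly iota f) != 0 by rewrite lead_coef_eq0 map_poly_eq0.
  have [ws zsE] : exists ws, zs = map h ws.
    have : {in zs, forall z, exists u, z = h u}.
      move=> z zzs; apply/memL/split_f; rewrite hzs rootZ // root_prod_XsubC //.
    elim: (zs) => [|z s IH] hs; first by exists [::].
    have [u ->] := hs z (mem_head _ _).
    by have [|ws ->] := IH; [move=> y ys; apply: hs; rewrite inE ys orbT|exists (u ::
      ws)].
  have fLE : fL = (lead_coef fL) *: \prod_(z <- ws) ('X - z%:P).
    apply: (map_poly_inj h); rewrite map_polyZ /= /fL hpoly [LHS]hzs zsE big_map.
    rewrite -lead_coef_map hpoly rmorph_prod; congr (_ *: _).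
    by apply: eq_bigr => w _; rewrite rmorphB /= map_polyX map_polyC.
  exists ws; first by rewrite {1}fLE eqp_scale // lead_coef_eq0 map_poly_eq0.
  apply/eqP; rewrite eqEsubv subvf -genr; apply/FadjoinP; split; first exact:
    subv_adjoin_seq.
  apply: seqv_sub_adjoin; move: root_fL; rewrite fLE rootZ ?root_prod_XsubC //.
  by rewrite lead_coef_eq0 map_poly_eq0.
pose L2 : splittingFieldType K := HB.pack L (FieldExt_isSplittingField.Build K L
  splitL).
move=> x /memL[u ->].
have sep_u : separable_element 1 u.
  by have /adjoin_separableP := sep_r; apply; rewrite genr memvf.
have /polyOver1P[g gE] := minPolyOver 1 u.
exists g; split.
- by move: sep_u; rewrite /separable_element gE separable_map.
- by rewrite -hpoly -gE fmorph_root root_minPoly.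
move=> y; rewrite -hpoly -gE; have [ys /eqP yE] := @splitting_field_normal K L2 1 u.
rewrite [minPoly _ _]yE rmorph_prod => hy; apply/memL.
have : y \in map h ys.
  rewrite -root_prod_XsubC big_map; congr (root _ y): hy; apply: eq_bigr => w _.
  by rewrite rmorphB /= map_polyX map_polyC.
by case/mapP => w _ ->; exists w.
Qed.

End SimpleExtension.

(** * Intermediate fields, automorphisms and their restriction *)

Section Intermediate.
Variables (K E : fieldType) (iota : {rmorphism K -> E}).
Implicit Types (L M B : set E).
Local Open Scope classical_set_scope.

Lemma sub_adjoin B : B `<=` adjoin iota B.
Proof. exact: sub_gen_smallest. Qed.

Lemma adjoin_min B L : intermediate iota L -> B `<=` L -> adjoin iota B `<=` L.
Proof. exact: smallest_sub. Qed.

Lemma intermediate_adjoin B : intermediate iota (adjoin iota B).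
Proof.
split=> [a|x y Lx Ly|x y Lx Ly|x Lx] M [iM BM]; first exact: intermediate_base iM a.
- by apply: (intermediateB iM); [apply: Lx | apply: Ly].
- by apply: (intermediateM iM); [apply: Lx | apply: Ly].
- by apply: (intermediateV iM); apply: Lx.
Qed.

Section Closure.
Variables (L : set E) (iL : intermediate iota L).

Lemma intermediate0 : L 0.
Proof. by rewrite -(rmorph0 iota); apply: intermediate_base iL _. Qed.

Lemma intermediateD x y : L x -> L y -> L (x + y).
Proof.
move=> Lx Ly; have Ny : L (- y).
  by rewrite -sub0r; apply: (intermediateB iL) => //; exact: intermediate0.
by rewrite -[y]opprK; apply: (intermediateB iL).
Qed.

Lemma intermediateX x n : L x -> L (x ^+ n).
Proof.
move=> Lx; elim: n => [|n IH]; first by rewrite expr0 -(rmorph1 iota); apply: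
  intermediate_base iL _.
by rewrite exprS; apply: (intermediateM iL).
Qed.

Lemma intermediate_horner (c : {poly K}) x : L x -> L (map_poly iota c).[x].
Proof.
move=> Lx; elim/poly_ind: c => [|c a IH]; first by rewrite map_poly0 horner0; exact:
  intermediate0.
rewrite rmorphD rmorphM /= map_polyX map_polyC hornerMXaddC.
by apply: intermediateD; [apply: (intermediateM iL) | apply: intermediate_base iL _].
Qed.

Variable s : autg iota L.

Lemma autg_mem x : L x -> L (s x).
Proof. by move=> Lx; have [[sL _ _] _ _ _ _] := autgP s; apply: sL. Qed.

Lemma autgX x n : L x -> s (x ^+ n) = s x ^+ n.
Proof.
move=> Lx; elim: n => [|n IH];
  first by rewrite !expr0 -(rmorph1 iota) (aut_base (autgP s)).
by rewrite !exprS (autM (autgP s)) ?IH //; apply: intermediateX.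
Qed.

Lemma autgB x y : L x -> L y -> s (x - y) = s x - s y.
Proof.
move=> Lx Ly; apply/eqP; rewrite eq_sym subr_eq -(autD (autgP s)) ?subrK //.
exact: (intermediateB iL).
Qed.

Lemma autgV x : L x -> s x^-1 = (s x)^-1.
Proof.
move=> Lx; have s0 : s 0 = 0 by rewrite -(rmorph0 iota) (aut_base (autgP s)).
have [->|x0] := eqVneq x 0; first by rewrite invr0 s0 invr0.
have sx0 : s x != 0 by apply: contraNneq x0 => sx; apply/eqP/(bij_inj (autg_bij s));
  rewrite sx s0.
apply: (mulfI sx0); rewrite mulfV // -(autM (autgP s)) // ?mulfV //.
  by rewrite -(rmorph1 iota) (aut_base (autgP s)).
exact: (intermediateV iL).
Qed.

End Closure.

Lemma autgVK L (s : autg iota L) : cancel s (s^-1)%g.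
Proof. by move=> x; have := congr1 (fun t : autg iota L => t x) (mulVg s). Qed.

Lemma autgKV L (s : autg iota L) : cancel (s^-1)%g s.
Proof. by move=> x; have := congr1 (fun t : autg iota L => t x) (mulgV s). Qed.

(** [autg_res] falls back on the identity unless the restriction is an automorphism. Stability is
    asked of every t because surjectivity of s on M uses that s^-1 preserves M. *)
Lemma autg_resE L M (s : autg iota L) : intermediate iota M -> M `<=` L ->
  (forall (t : autg iota L) x, M x -> M (t x)) -> forall x, M x -> autg_res M s x = s x.
Proof.
move=> iM ML stab x Mx; rewrite /autg_res; case: pselect => [sP|nP] /=.
  by case: asboolP.
exfalso; apply: nP; split=> [|y nMy|a|y z My Mz|y z My Mz]; first split.
- by move=> y My /=; case: asboolP => // _; apply: stab.
- move=> y z /set_mem My /set_mem Mz /=.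
  by case: asboolP => // _; case: asboolP => // _ /(bij_inj (autg_bij s)).
- move=> y My; exists ((s^-1)%g y); first exact: stab.
  by case: asboolP => [_|[]]; rewrite ?autgKV //; apply: stab.
- by case: asboolP.
- by case: asboolP => // _; exact: aut_base (autgP s) a.
- have Myz := intermediateD iM My Mz.
  by do 3!case: asboolP => // _; apply: (autD (autgP s)); apply: ML.
- have Myz := intermediateM iM My Mz.
  by do 3!case: asboolP => // _; apply: (autM (autgP s)); apply: ML.
Qed.

End Intermediate.

Section AutCarlitz.
Variables (F : finFieldType) (E : fieldType) (iota :
  {rmorphism {fraction {poly F}} -> E}).
Variables (L : set E) (iL : intermediate iota L).
Notation ev := (carlitz_eval iota).
Local Open Scope classical_set_scope.

Lemma intermediate_eval a x : L x -> L (ev a x).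
Proof.
move=> Lx; elim/poly_ind: a => [|a c IH]; first by rewrite carlitz_eval0; exact:
  intermediate0 iL.
rewrite carlitz_evalDl carlitz_evalMX -[c%:P]alg_polyC carlitz_evalZ carlitz_eval1.
have Lb a' : L (ofA iota a') by apply: intermediate_base iL _.
apply: (intermediateD iL); last exact: (intermediateM iL).
by apply: (intermediateD iL); [apply: (intermediateM iL) | apply: (intermediateX iL)].
Qed.

Lemma autg_eval (s : autg iota L) a x : L x -> s (ev a x) = ev a (s x).
Proof.
have sb b : s (ofA iota b) = ofA iota b by apply: aut_base (autgP s) _.
have Lb b : L (ofA iota b) by apply: intermediate_base iL _.
move=> Lx; elim/poly_ind: a => [|a c IH].
  by rewrite !carlitz_eval0 -(rmorph0 (ofA iota)) sb.
rewrite !carlitz_evalDl !carlitz_evalMX -[c%:P]alg_polyC !carlitz_evalZ !carlitz_eval1.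
have Lax := intermediate_eval a Lx; have Laxq := intermediateX iL #|F| Lax.
have LX := intermediateM iL (Lb 'X) Lax; have Lc := intermediateM iL (Lb c%:P) Lx.
rewrite (autD (autgP s)) // ?(autD (autgP s)) ?(autM (autgP s)) ?sb ?IH //;
  last exact: (intermediateD iL).
by rewrite (autgX iL) // IH.
Qed.

Lemma autg_torsion (s : autg iota L) a x : L x -> torsion iota a x ->
  torsion iota a (s x).
Proof.
rewrite /torsion /= => Lx ax; rewrite -autg_eval // ax.
by rewrite -(rmorph0 (ofA iota)); apply: aut_base (autgP s) _.
Qed.

Lemma autg_torsion_field (s : autg iota L) a x :
  torsion iota a `<=` L -> adjoin iota (torsion iota a) x ->
    adjoin iota (torsion iota a) (s x).
Proof.
move=> aL ax; have aL' := adjoin_min iL aL;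
  have iM := intermediate_adjoin iota (torsion iota a).
set M := adjoin _ _ in aL' iM ax *.
(* An adjunction is known only through its minimality, so the claim is turned into an intermediate
   field containing the torsion points. *)
have hI : intermediate iota [set z | L z /\ M (s z)].
  split=> [b|y z [Ly My] [Lz Mz]|y z [Ly My] [Lz Mz]|y [Ly My]]; split.
  - exact: intermediate_base iL _.
  - by rewrite (aut_base (autgP s)); exact: intermediate_base iM _.
  - exact: (intermediateB iL).
  - by rewrite (autgB iL) //; exact: (intermediateB iM).
  - exact: (intermediateM iL).
  - by rewrite (autM (autgP s)) //; exact: (intermediateM iM).
  - exact: (intermediateV iL).
  - by rewrite (autgV iL) //; exact: (intermediateV iM).
have [] // := adjoin_min hI _ ax.
move=> y ay; split; first exact: aL.
by apply: sub_adjoin; apply: autg_torsion => //; apply: aL.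
Qed.

End AutCarlitz.

(** * The extensions F(Phi[P^n]) are Galois and abelian *)

Section TorsionField.
Variables (F : finFieldType) (E : closedFieldType).
Variables (iota : {rmorphism {fraction {poly F}} -> E}).
Variables (P : {poly F}) (prP : is_prime P) (n : nat).
Notation ev := (carlitz_eval iota).
Notation L := (adjoin iota (torsion iota (P ^+ n))).
Local Open Scope classical_set_scope.

Lemma map_poly_ofA (c : {poly {poly F}}) :
  map_poly iota (map_poly (@tofrac _) c) = map_poly (ofA iota) c.
Proof. by rewrite -map_poly_comp. Qed.

Lemma torsion_field_simple l : torsion iota (P ^+ n) l ->
  (forall x, torsion iota (P ^+ n) x -> exists a, x = ev a l) ->
  L = simple_ext iota l /\ galois_ext iota L.
Proof.
move=> tl gen; pose f := map_poly (@tofrac _) (carlitz_poly (P ^+ n)).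
have evS a : simple_ext iota l (ev a l).
  by exists (map_poly (@tofrac _) (carlitz_poly a));
    rewrite map_poly_ofA carlitz_eval_poly.
have Pn0 : P ^+ n != 0 by rewrite expf_neq0 // prime_neq0.
have [||y|iS gS] := @simple_ext_galois _ E iota l f.
- by rewrite -(separable_map iota) map_poly_ofA separable_carlitz_poly.
- by rewrite map_poly_ofA rootE -carlitz_eval_poly tl.
- by rewrite map_poly_ofA rootE -carlitz_eval_poly => /eqP/gen[a ->].
suff -> : L = simple_ext iota l by [].
apply/seteqP; split.
  by apply: adjoin_min => // x /gen[a ->].
move=> _ [c ->]; apply: (intermediate_horner (intermediate_adjoin _ _)).
exact: sub_adjoin.
Qed.

(** Two automorphisms send a generator l to some Phi_b(l) and Phi_c(l); they commute at l because
    Phi_b and Phi_c commute with each other and with automorphisms. The elements at which they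
    commute form a field. *)
Lemma torsion_field_abelian : abelian_ext iota L.
Proof.
have [l [tl _ gen]] := torsion_generator iota prP n.
split; first by have [] := torsion_field_simple tl gen.
have iL := intermediate_adjoin iota (torsion iota (P ^+ n)).
have tL := @sub_adjoin _ _ iota (torsion iota (P ^+ n)).
move=> s t; apply: autg_inj; apply/funext => x /=.
have [Lx|nLx] := pselect (L x); last first.
  by rewrite !(aut_out (autgP _) nLx).
have mem (u : autg iota L) z : L z -> L (u z) := @autg_mem _ _ _ _ u z.
have hI : intermediate iota [set z | L z /\ s (t z) = t (s z)].
  split=> [b|y z [Ly My] [Lz Mz]|y z [Ly My] [Lz Mz]|y [Ly My]]; split.
  - exact: intermediate_base iL _.
  - by rewrite !(aut_base (autgP _)).
  - exact: (intermediateB iL).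
  - by rewrite !(autgB iL) ?My ?Mz //; apply: mem.
  - exact: (intermediateM iL).
  - by rewrite !(autM (autgP _)) ?My ?Mz //; apply: mem.
  - exact: (intermediateV iL).
  - by rewrite !(autgV iL) ?My //; apply: mem.
have [] // := adjoin_min hI _ Lx.
move=> _ /gen[a ->]; have Ll := tL _ tl; split; first exact: (intermediate_eval iL).
rewrite !(autg_eval iL) //; try exact: mem.
have [b tb] := gen _ (autg_torsion iL t Ll tl);
  have [c sc] := gen _ (autg_torsion iL s Ll tl).
by rewrite tb sc !(autg_eval iL) // tb sc [ev b (ev c l)]carlitz_eval_comm.
Qed.

End TorsionField.

(** * Places and ramification *)

Lemma fraction_numden (R : idomainType) (x : {fraction R}) :
  exists n d, d != 0 /\ x * tofrac d = tofrac n.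
Proof.
elim/quotW: x => x; exists (frac x).1, (frac x).2; split; first exact: denom_ratioP.
rewrite -[LHS]/(FracField.mul _ _) !piE; apply/eqmodP => /=.
rewrite FracField.equivfE /FracField.mulf !numden_Ratio ?oner_eq0 ?mulf_neq0
  ?denom_ratioP ?oner_eq0 //.
by rewrite !mulr1 mulrC.
Qed.

Lemma clear_denominators (R : idomainType) (c : {poly {fraction R}}) :
  exists a (c' : {poly R}), a != 0 /\ map_poly (@tofrac R) c' = tofrac a *: c.
Proof.
elim/poly_ind: c => [|c x [a [c' [a0 e]]]].
  by exists 1, 0; rewrite oner_neq0 rmorph0 scaler0.
have [n [d [d0 xd]]] := fraction_numden x.
exists (a * d), (d *: (c' * 'X) + (a * n)%:P); split; first exact: mulf_neq0.
rewrite rmorphD /= map_polyZ rmorphM /= map_polyX map_polyC e scalerDr /= !tofracM -xd.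
congr (_ + _); first by rewrite -scalerAl scalerA mulrC.
by rewrite -mul_polyC -polyCM; congr (_%:P); rewrite mulrCA mulrC.
Qed.

Section Places.
Variables (F : finFieldType) (E : closedFieldType).
Variables (iota : {rmorphism {fraction {poly F}} -> E}).
Notation A := {poly F}.
Variables (L : set E) (iL : intermediate iota L) (Q : A) (prQ : is_prime Q).
Variables (V : set E) (pV : place_above iota L Q V).
Notation m := (nonunits V).
Implicit Types (a b : A) (x y z : E).

Lemma place_ofA a : V (ofA iota a). Proof. exact: place_base pV a. Qed.

Lemma place0 : V 0. Proof. by rewrite -(rmorph0 (ofA iota)); exact: place_ofA. Qed.

Lemma place1 : V 1. Proof. by rewrite -(rmorph1 (ofA iota)); exact: place_ofA. Qed.

Lemma placeN x : V x -> V (- x).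
Proof. by move=> Vx; rewrite -sub0r; apply: (placeB pV) => //; exact: place0. Qed.

Lemma placeD x y : V x -> V y -> V (x + y).
Proof. by move=> Vx /placeN Vy; rewrite -[y]opprK; apply: (placeB pV). Qed.

Lemma placeX x n : V x -> V (x ^+ n).
Proof.
move=> Vx; elim: n => [|n IH]; first by rewrite expr0; exact: place1.
by rewrite exprS; apply: (placeM pV).
Qed.

Lemma place_horner (c : {poly A}) x : V x -> V (map_poly (ofA iota) c).[x].
Proof.
move=> Vx; elim/poly_ind: c => [|c a IH]; first by rewrite rmorph0 horner0; exact:
  place0.
rewrite rmorphD rmorphM /= map_polyX map_polyC hornerMXaddC.
by apply: placeD; [apply: (placeM pV) | exact: place_ofA].
Qed.

Lemma nonunit_place x : m x -> V x. Proof. by case. Qed.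

Lemma unit_placeV x : V x -> ~ m x -> x != 0 /\ V x^-1.
Proof.
move=> Vx nmx; split; last by apply: contrapT => nV; apply: nmx; split=> //; right.
by apply/eqP => x0; apply: nmx; split=> //; left.
Qed.

Lemma nonunitMr x y : m x -> V y -> m (x * y).
Proof.
move=> [Vx xP] Vy; split; first exact: (placeM pV).
have [->|xy0] := eqVneq (x * y) 0; first by left.
right=> Vxy; case: xP => [x0|]; first by rewrite x0 mul0r eqxx in xy0.
apply; have -> : x^-1 = y * (x * y)^-1.
  by move: xy0; rewrite mulf_eq0 => /norP[x0 y0];
    rewrite invfM mulrA mulrAC mulfV ?mul1r.
exact: (placeM pV).
Qed.

Lemma nonunitMl x y : V x -> m y -> m (x * y).
Proof. by move=> Vx my; rewrite mulrC; apply: nonunitMr. Qed.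

Lemma nonunit0 : m 0. Proof. by split; [exact: place0 | left]. Qed.

Lemma nonunitN x : m x -> m (- x).
Proof. by move=> mx; rewrite -mulrN1; apply: nonunitMr => //; apply/placeN/place1. Qed.

Lemma nonunitD x y : m x -> m y -> m (x + y).
Proof.
move=> mx my; have [->|x0] := eqVneq x 0; first by rewrite add0r.
have [->|y0] := eqVneq y 0; first by rewrite addr0.
have [Lx Ly] := (place_sub pV (nonunit_place mx), place_sub pV (nonunit_place my)).
have Lxy : L (x / y) by apply: (intermediateM iL) => //; apply: (intermediateV iL).
case: (place_total pV Lxy) => h.
  have -> : x + y = y * (x / y + 1) by rewrite mulrDr mulr1 mulrC divfK.
  by apply: nonunitMr => //; apply: placeD => //; exact: place1.
have -> : x + y = x * (1 + (x / y)^-1) by rewrite mulrDr mulr1 invf_div [x * _]mulrC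
  divfK.
by apply: nonunitMr => //; apply: placeD => //; exact: place1.
Qed.

Lemma nonunitB x y : m x -> m y -> m (x - y).
Proof. by move=> mx /nonunitN; apply: nonunitD. Qed.

Lemma nonunit1 : ~ m 1.
Proof. by case=> _ [/eqP|]; rewrite ?oner_eq0 // invr1; apply; exact: place1. Qed.

Lemma nonunit_prime x y : V x -> V y -> m (x * y) -> m x \/ m y.
Proof.
move=> Vx Vy mxy; have [|nmx] := pselect (m x); first by left.
right; have [x0 Vx'] := unit_placeV Vx nmx.
by rewrite -[y]mul1r -(mulVf x0) -mulrA; apply: nonunitMl.
Qed.

Lemma nonunit_ofA a : m (ofA iota a) <-> dvdr Q a.
Proof. by rewrite (place_center pV) dvdrE. Qed.

Lemma nonunit_sum (I : Type) (r : seq I) (D : pred I) (h : I -> E) :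
  (forall i, D i -> m (h i)) -> m (\sum_(i <- r | D i) h i).
Proof. by move=> hm; elim/big_ind: _ => //; [exact: nonunit0 | exact: nonunitD]. Qed.

(** Valuation rings are integrally closed: if x is not in V, then x^-1 is a nonunit, and dividing
    the equation by the top power of x makes 1 a nonunit. *)
Lemma place_integral (c : {poly A}) x : c \is monic -> L x ->
  root (map_poly (ofA iota) c) x -> V x.
Proof.
move=> cm Lx cx; apply: contrapT => nVx; have Vx' : V x^-1.
  by case: (place_total pV Lx).
have x0 : x != 0 by apply/eqP => x0; apply: nVx; rewrite x0; exact: place0.
have mx' : m x^-1 by split=> //; right; rewrite invrK.
apply: nonunit1; have s0 : size c != 0 by rewrite size_poly_eq0 monic_neq0.
have := rootP cx; rewrite horner_coef size_map_inj_poly ?rmorph0 //; last exact: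
  ofA_inj.
rewrite -(prednK (n := size c)) ?lt0n // big_ord_recr /= coef_map /= -lead_coefE
  (monicP cm).
rewrite rmorph1 mul1r => /(congr1 (fun z => x^-1 ^+ (size c).-1 * z)).
rewrite mulr0 mulrDr -exprMn mulVf // expr1n => /eqP; rewrite addrC addr_eq0 => /eqP ->.
apply/nonunitN; rewrite mulr_sumr; apply: nonunit_sum => -[i ic] _.
rewrite coef_map /= mulrCA; apply: nonunitMl; first exact: place_ofA.
rewrite -(subnK ic) addnS -addSn exprD -mulrA -exprMn mulVf // expr1n mulr1 exprS.
by apply: nonunitMr => //; apply: placeX.
Qed.

Hypothesis hE : forall x, algebraicOver iota x.

(* V need not be discrete a priori; but z divides the constant term of an
   algebraic equation that it satisfies over A. *)
Lemma place_order_bound z : V z -> z != 0 ->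
  exists N, forall y, V y -> z <> ofA iota Q ^+ N * y.
Proof.
move=> Vz z0; have [c c0 cz] : exists2 c :
  {poly A}, c`_0 != 0 & root (map_poly (ofA iota) c) z.
  have [f f0 fz] := hE z; have [a [c [a0 ce]]] := clear_denominators f.
  have cz : root (map_poly (ofA iota) c) z.
    by rewrite -map_poly_ofA ce map_polyZ rootZ // fmorph_eq0 tofrac_eq0.
  have c0 : c != 0.
    apply: contraNneq f0 => c0; move: ce; rewrite c0 rmorph0 => /esym/eqP.
    by rewrite scaler_eq0 tofrac_eq0 (negPf a0).
  elim/poly_ind: c {ce f f0 fz} cz c0 => [|c b IH]; first by rewrite eqxx.
  have [->|b0] := eqVneq b 0.
    rewrite addr0 rmorphM /= map_polyX rootM rootX (negPf z0) orbF => cz.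
    by rewrite mulf_eq0 => /norP[c0 _]; apply: IH.
  by move=> cz _; exists (c * 'X + b%:P) => //; rewrite coefD coefMX coefC add0r.
(* With k the order of Q in the constant term Q^k b, divisibility of z by Q^(k+1) would make Q
   divide b in V, although Q does not divide b in A. *)
have [k [b [c0E nb]]] := prime_split prQ c0.
exists k.+1 => y Vy zE; apply/negP: nb; apply/negPn/dvdrE/nonunit_ofA.
have QE : V (ofA iota Q) by exact: place_ofA.
have Q0 : ofA iota Q ^+ k != 0 by rewrite expf_neq0 // ofA_eq0 prime_neq0.
have [c1 cE] : exists c1, c = c1 * 'X + (c`_0)%:P.
  by elim/poly_ind: c {cz c0 c0E} => [|c1 a _]; [exists 0; rewrite coef0 mul0r add0r |
     exists c1; rewrite coefD coefMX coefC add0r].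
move: cz; rewrite cE rmorphD rmorphM /= map_polyX map_polyC rootE hornerMXaddC /= c0E.
rewrite rmorphM rmorphXn /= addrC addr_eq0 {2}zE => /eqP.
rewrite exprSr => e; have -> :
  ofA iota b = ofA iota Q * - ((map_poly (ofA iota) c1).[z] * y).
  by apply: (mulfI Q0); rewrite e; ring.
apply: nonunitMr; first by apply/nonunit_ofA/dvdrr.
by apply/placeN/(placeM pV) => //; apply: place_horner.
Qed.

End Places.

(** * Unramifiedness at places where f'(l) is a unit *)

Section Unramified.
Variables (F : finFieldType) (E : closedFieldType).
Variables (iota : {rmorphism {fraction {poly F}} -> E}).
Hypothesis hE : forall x, algebraicOver iota x.
Notation A := {poly F}.
Notation ofA := (ofA iota).
Notation "c ^ofA" := (map_poly ofA c) (at level 2, format "c ^ofA").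

Section SimplePlace.
Variables (l : E) (Q : A) (prQ : is_prime Q) (V : set E).
Notation L := (simple_ext iota l).
Hypotheses (iL : intermediate iota L) (pV : place_above iota L Q V).
Notation m := (nonunits V).
Variable (f : {poly A}).
Hypotheses (f_monic : f \is monic) (fl0 : root f^ofA l) (f'l : ~ m (f^`()^ofA).[l]).

Let Vl : V l.
Proof.
apply: (place_integral iL pV f_monic) => //; exists 'X.
by rewrite map_polyX hornerX.
Qed.

Let Vc (c : {poly A}) : V c^ofA.[l]. Proof. exact: (place_horner pV). Qed.

Let mQ : m (ofA Q). Proof. by apply/(nonunit_ofA pV)/dvdrr. Qed.

Let reduced (h : {poly A}) := h \is monic /\ m h^ofA.[l].

(* A monic polynomial of minimal degree among those vanishing at l in the
   residue field of V; it lifts the minimal polynomial of l there. *)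
Let residue_minpoly : exists h, reduced h /\ forall h', reduced h' ->
  (size h <= size h')%N.
Proof.
have ex : exists n, `[< exists2 h, reduced h & size h = n >].
  exists (size f); apply/asboolP; exists f => //; split=> //.
  by rewrite (rootP fl0); apply: (nonunit0 pV).
case: (ex_minnP ex) => n /asboolP[h rh hn] hmin; exists h; split=> // h' rh'.
by rewrite hn; apply: hmin; apply/asboolP; exists h'.
Qed.

(** A leading coefficient divisible by Q is stripped off and the induction continues. Otherwise it
    is invertible modulo Q, and r can be made monic without changing its vanishing in the residue
    field, against the minimality of h. *)
Let residue_small (h r : {poly A}) : (forall h', reduced h' -> (size h <= size h')%N) ->
  m r^ofA.[l] -> (size r < size h)%N -> exists w, r = Q *: w.
Proof.
move=> hmin; have [n] := ubnP (size r); elim: n r => // n IH r rn mr rh.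
have [->|r0] := eqVneq r 0; first by exists 0; rewrite scaler0.
pose k := (size r).-1; have sr :
  size r = k.+1 by rewrite /k prednK // lt0n size_poly_eq0.
have szX (a : A) : (size (r - a *: 'X^k)%R <= k.+1)%N.
  rewrite (leq_trans (size_polyD _ _)) // geq_max sr leqnn size_polyN.
  by rewrite (leq_trans (size_scale_leq _ _)) // size_polyXn.
have mZ (a : A) (c : {poly A}) : m c^ofA.[l] -> m (a *: c)^ofA.[l].
  by move=> mc; rewrite map_polyZ hornerZ; apply: (nonunitMl pV) => //; exact:
    (place_ofA pV).
have mQZ (a : A) (c : {poly A}) : m ((Q * a) *: c)^ofA.[l].
  rewrite map_polyZ hornerZ rmorphM -mulrA; apply: (nonunitMr pV) => //.
  by apply: (placeM pV) => //; exact: (place_ofA pV).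
have mB (c c' : {poly A}) : m c^ofA.[l] -> m c'^ofA.[l] -> m (c - c')^ofA.[l].
  by move=> mc mc'; rewrite rmorphB hornerD hornerN; apply: (nonunitB iL pV).
have [/dvdrE[t lt]|nQ] := boolP (Q %| lead_coef r).
  have [|||w rE] := IH (r - (Q * t) *: 'X^k).
  - apply: leq_ltn_trans (_ : (size (r - (Q * t) *: 'X^k)%R <= k)%N) _.
      apply/leq_sizeP => i; rewrite leq_eqVlt => /predU1P[<-|ki].
        by rewrite coefB coefZ coefXn eqxx mulr1 -lt lead_coefE subrr.
      by rewrite coefB coefZ coefXn gtn_eqF // mulr0 subr0 nth_default // sr.
    by rewrite -ltnS -sr.
  - exact: mB.
  - by apply: leq_ltn_trans (szX _) _; rewrite -sr.
  by exists (w + t *: 'X^k); rewrite scalerDr -rE scalerA subrK.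
(* The leading coefficient of s r is 1 + Q t; subtracting Q t X^k makes it 1 and changes the value
   at l by a nonunit. *)
have [s [t st]] := prime_bezout 1 prQ nQ; rewrite expr1 in st.
have : reduced (s *: r - (Q * t) *: 'X^k).
  have lk : (s *: r - (Q * t) *: 'X^k)`_k = 1.
    by rewrite coefB !coefZ coefXn eqxx mulr1 -lead_coefE -st mulrC; ring.
  have sk : (size (s *: r - (Q * t) *: 'X^k)%R <= k.+1)%N.
    rewrite (leq_trans (size_polyD _ _)) // geq_max size_polyN -{1}sr size_scale_leq.
    by rewrite (leq_trans (size_scale_leq _ _)) // size_polyXn.
  have sE : size (s *: r - (Q * t) *: 'X^k) = k.+1.
    apply/eqP; rewrite eqn_leq sk ltnNge; apply/negP => /leq_sizeP/(_ k (leqnn k)).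
    by rewrite lk => /eqP; rewrite oner_eq0.
  split; first by rewrite monicE lead_coefE sE lk.
  by apply: mB => //; apply: mZ.
move=> /hmin; rewrite leqNgt => /negP[]; apply: leq_ltn_trans rh.
rewrite (leq_trans (size_polyD _ _)) // geq_max size_polyN size_scale_leq.
by rewrite (leq_trans (size_scale_leq _ _)) // size_polyXn -sr.
Qed.

(** The kernel of the reduction A[X] -> V/m at l is generated by h and Q: divide by the monic h and
    apply [residue_small] to the remainder. *)
Let residue_div : exists h, reduced h /\
  forall c, m c^ofA.[l] -> exists u w, c = u * h + Q *: w.
Proof.
have [h [rh hmin]] := residue_minpoly; exists h; split=> // c mc.
have := Pdiv.RingMonic.rdivp_eq rh.1 c.
have := Pdiv.CommonRing.ltn_rmodpN0 c (monic_neq0 rh.1).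
move: (Pdiv.CommonRing.rdivp c h) (Pdiv.CommonRing.rmodp c h) => u r sr cE.
have mr : m r^ofA.[l].
  have -> : r = c - u * h by rewrite cE addrAC subrr add0r.
  rewrite rmorphB rmorphM hornerD hornerN hornerM; apply: (nonunitB iL pV) => //.
  exact: (nonunitMl pV (Vc u) rh.2).
by have [w rw] := residue_small hmin mr sr; exists u, w; rewrite -rw.
Qed.

(** Write f = u h + Q w. Then f'(l) = u(l) h'(l) modulo m, so u(l) is a unit, and f(l) = 0 gives
    u(l) h(l) = -Q w(l). Hence Q divides h(l) up to a unit, and with it every nonunit of A[l]. *)
Let nonunit_div : exists u, ~ m u^ofA.[l] /\ forall c, m c^ofA.[l] ->
  exists w, c^ofA.[l] * u^ofA.[l] = ofA Q * w^ofA.[l].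
Proof.
have [h [rh hdiv]] := residue_div.
have [u [w fE]] : exists u w, f = u * h + Q *: w.
  by apply: hdiv; rewrite (rootP fl0); apply: (nonunit0 pV).
have ev c c' t : (c * c' + Q *: t)^ofA.[l] = c^ofA.[l] * c'^ofA.[l] + ofA Q * t^ofA.[l].
  by rewrite rmorphD rmorphM /= map_polyZ hornerD hornerM hornerZ.
exists u; split=> [mu|c /hdiv[u' [w' cE]]].
  apply: f'l; rewrite fE derivD derivM derivZ rmorphD hornerD /= rmorphD hornerD /=.
  rewrite !rmorphM !hornerM map_polyZ hornerZ.
  apply: (nonunitD iL pV); last exact: (nonunitMr pV).
  by apply: (nonunitD iL pV); [exact: (nonunitMl pV (Vc _) rh.2) | exact:
    (nonunitMr pV mu (Vc _))].
have e := ev u h w; rewrite -fE (rootP fl0) in e.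
exists (w' * u - u' * w).
rewrite cE ev rmorphB !rmorphM hornerD hornerN !hornerM /=.
move: e => /esym/eqP; rewrite addr_eq0 => /eqP e.
transitivity (u'^ofA.[l] * (u^ofA.[l] * h^ofA.[l]) + ofA Q * w'^ofA.[l] * u^ofA.[l]);
  first by ring.
by rewrite e; ring.
Qed.

Let order_exists (c : {poly A}) : c^ofA.[l] != 0 ->
  exists k w, [/\ V w, ~ m w & c^ofA.[l] = ofA Q ^+ k * w].
Proof.
move=> c0; have [u [nmu udiv]] := nonunit_div.
have [N hN] := place_order_bound prQ pV hE (Vc c) c0.
have Vu n : V (u^ofA.[l] ^+ n)^-1.
  by rewrite -exprVn; apply: (placeX pV); have [] := unit_placeV (Vc u) nmu.
have nmuV n : ~ m (u^ofA.[l] ^+ n)^-1.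
  have [u0 _] := unit_placeV (Vc u) nmu; move=> /(nonunitMl pV (placeX pV n (Vc u))).
  by rewrite mulfV ?expf_neq0 //; exact: (nonunit1 pV).
(* If no quotient were ever a unit, division by Q could be repeated forever, against the bound N. *)
apply: contrapT => nk; have : forall n, exists c', c^ofA.[l] * u^ofA.[l] ^+ n = ofA Q
  ^+ n * c'^ofA.[l].
  elim=> [|n [c' e]]; first by exists c; rewrite !expr0 mulr1 mul1r.
  have [u0 _] := unit_placeV (Vc u) nmu.
  have [mc'|nmc'] := pselect (m c'^ofA.[l]).
    by have [w e'] := udiv _ mc'; exists w;
      rewrite exprS mulrCA e mulrCA [_ * c'^ofA.[l]]mulrC e' mulrA -exprSr.
  case: nk; exists n, (c'^ofA.[l] * (u^ofA.[l] ^+ n)^-1); split.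
  - by apply: (placeM pV).
  - by move=> /(nonunit_prime pV (Vc _) (Vu n))[|]; [exact: nmc' | exact: nmuV].
  - by rewrite mulrA -e mulfK // expf_neq0.
move=> /(_ N)[c' e]; apply: (hN (c'^ofA.[l] * (u^ofA.[l] ^+ N)^-1)); first by apply:
  (placeM pV).
by have [u0 _] := unit_placeV (Vc u) nmu; rewrite mulrA -e mulfK // expf_neq0.
Qed.

Lemma simple_place_unramified x : m x -> exists2 y, V y & x = ofA Q * y.
Proof.
move=> mx; have [->|x0] := eqVneq x 0; first by exists 0; rewrite ?mulr0 //; exact:
  place0 pV.
have [c0 xE] := place_sub pV (nonunit_place mx).
have [a [c [a0 cE]]] := clear_denominators c0.
have xcE : c^ofA.[l] = ofA a * x.
  by rewrite -map_poly_ofA cE map_polyZ hornerZ -xE.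
have ofAa0 : ofA a != 0 by rewrite ofA_eq0.
have [|k [w [Vw nmw e]]] := order_exists (c := c); first by rewrite xcE mulf_neq0.
have [n [b [aE nb]]] := prime_split prQ a0.
have Q0 : ofA Q != 0 by rewrite ofA_eq0 prime_neq0.
have nmb : ~ m (ofA b) by move=> /(nonunit_ofA pV)/dvdrE; apply/negP.
have [b0 Vb] := unit_placeV (place_ofA pV b) nmb; have [w0 Vw'] := unit_placeV Vw nmw.
move: e; rewrite xcE aE rmorphM rmorphXn /= => e.
(* x is Q^(k-n) times a unit w/b; k <= n would put x^-1 in V. *)
have [kn|nk] := leqP k n.
  case: (mx) => _ [/eqP|]; first by rewrite (negPf x0).
  case; have -> : x^-1 = ofA Q ^+ (n - k) * ofA b * w^-1.
    apply: (mulIf x0); rewrite mulVf // [RHS]mulrAC; apply: (mulfI (expf_neq0 k Q0)).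
    by rewrite mulr1 !mulrA -exprD subnKC // e -mulrA mulfV // mulr1.
  apply: (placeM pV) => //; apply: (placeM pV); last exact: (place_ofA pV).
  by apply: (placeX pV); exact: (place_ofA pV).
exists (ofA Q ^+ (k - n.+1) * w * (ofA b)^-1).
  apply: (placeM pV) => //; apply: (placeM pV) => //.
  by apply: (placeX pV); exact: (place_ofA pV).
have kE : ofA Q ^+ k = ofA Q * ofA Q ^+ n * ofA Q ^+ (k - n.+1) by rewrite -exprS
  -exprD subnKC.
by apply: (mulfI (mulf_neq0 (expf_neq0 n Q0) b0)); rewrite e kE; field.
Qed.

End SimplePlace.

(** Here f'(l) is the constant P^n, a unit at every place above Q. *)
Lemma torsion_field_unramified (P Q : A) n : is_prime P -> is_prime Q -> Q <> P ->
  unramified_at iota (adjoin iota (torsion iota (P ^+ n))) Q.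
Proof.
move=> prP prQ QP V; have [l [tl _ gen]] := torsion_generator iota prP n.
have iL := intermediate_adjoin iota (torsion iota (P ^+ n)).
have [LE _] := torsion_field_simple prP tl gen; rewrite LE in iL * => pV.
have Pnm : P ^+ n \is monic by rewrite monic_exp // prP.1.
apply: (simple_place_unramified prQ iL pV (f := carlitz_poly (P ^+ n))).
- by have [] := carlitz_poly_monic Pnm.
- by rewrite rootE -carlitz_eval_poly tl.
rewrite deriv_carlitz_poly map_polyC hornerC /= (nonunit_ofA pV) dvdrE.
exact/negP/prime_ndvd_expr.
Qed.

End Unramified.

(** * Frobenius elements and kappa *)

Section Tower.
Variables (F : finFieldType) (E : closedFieldType).
Variables (iota : {rmorphism {fraction {poly F}} -> E}).
Hypothesis hE : forall x, algebraicOver iota x.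
Notation A := {poly F}.
Notation q := #|F|.
Notation ev := (carlitz_eval iota).
Variables (P : A) (prP : is_prime P).
Notation L := (max_abelian iota P).
Notation M := (cyclotomic_tower iota P).
Local Open Scope classical_set_scope.

Lemma torsion_field_sub n : adjoin iota (torsion iota (P ^+ n)) `<=` L.
Proof.
move=> x Lx; apply: sub_adjoin; exists (adjoin iota (torsion iota (P ^+ n))) => //;
  split.
- exact: intermediate_adjoin.
- exact: torsion_field_abelian.
- by move=> Q prQ QP; apply: torsion_field_unramified.
Qed.

Lemma torsion_sub n : torsion iota (P ^+ n) `<=` L.
Proof. by move=> x tx; apply: (@torsion_field_sub n); apply: sub_adjoin. Qed.

Lemma intermediate_tower : intermediate iota M.
Proof.
have iL n := intermediate_adjoin iota (torsion iota (P ^+ n)).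
have mono m n : (m <= n)%N ->
    adjoin iota (torsion iota (P ^+ m)) `<=` adjoin iota (torsion iota (P ^+ n)).
  move=> mn; apply: adjoin_min => // x tx; apply: sub_adjoin; exact: torsion_exp mn tx.
have common x y : M x -> M y -> exists n, adjoin iota (torsion iota (P ^+ n)) x /\
    adjoin iota (torsion iota (P ^+ n)) y.
  move=> [m _ mx] [n _ ny]; exists (maxn m n); split.
    exact: mono (leq_maxl _ _) _ mx.
  exact: mono (leq_maxr _ _) _ ny.
split=> [a|x y Mx My|x y Mx My|x [n _ nx]].
- by exists 0%N => //=; apply: intermediate_base (iL _) _.
- by have [n [nx ny]] := common x y Mx My; exists n => //=; apply:
  (intermediateB (iL n)).
- by have [n [nx ny]] := common x y Mx My; exists n => //=; apply:
  (intermediateM (iL n)).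
- by exists n => //=; apply: (intermediateV (iL n)).
Qed.

Lemma tower_resE (s : autg iota L) x : M x -> autg_res M s x = s x.
Proof.
have iL : intermediate iota L by apply: intermediate_adjoin.
apply: autg_resE; first exact: intermediate_tower.
  by move=> y [n _ ny]; apply: torsion_field_sub ny.
move=> t y [n _ ny]; exists n => //; apply: (autg_torsion_field iL) => //.
exact: torsion_sub.
Qed.

Lemma torsion_tower n : torsion iota (P ^+ n) `<=` M.
Proof. by move=> x tx; exists n => //; apply: sub_adjoin. Qed.

Section Frobenius.
Variables (Q : A) (prQ : is_prime Q) (QP : Q <> P).

(** Reduction above Q is injective on a-torsion: for t nonzero, dividing Phi_a(t) = 0 by t expresses
    a as a combination of the t^(q^i - 1) with i > 0, which are nonunits if t is. *)
Lemma torsion_nonunit (N : set E) (iN : intermediate iota N) (V : set E)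
    (pV : place_above iota N Q V) (a : A) t :
  ~~ (Q %| a) -> torsion iota a t -> nonunits V t -> t = 0.
Proof.
move=> nQa ta mt; apply/eqP/negPn/negP => t0; case/negP: nQa;
  apply/dvdrE/(nonunit_ofA pV).
move: ta; rewrite /torsion /= (carlitz_evalE _ _ (leqnSn (size a))) big_ord_recl /=.
rewrite coef0_carlitz expn0 expr1 => /eqP; rewrite addr_eq0 => /eqP e.
rewrite -[ofA _ _](mulfK t0) e mulNr mulr_suml;
  apply/(nonunitN pV)/(nonunit_sum iN pV) => i _.
rewrite -mulrA; apply: (nonunitMl pV); first exact: (place_ofA pV).
have -> : t ^+ (q ^ bump 0 i) / t = t * t ^+ (q ^ bump 0 i - 2).
  have : (1 < q ^ bump 0 i)%N by rewrite -{1}(expn0 q) ltn_exp2l // finNzRing_gt1.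
  by case: (q ^ _)%N => // -[//|k] _;
    rewrite !exprS subSS subSS subn0 mulrAC mulfV // mul1r.
by apply: (nonunitMr pV) => //; apply: (placeX pV); apply: nonunit_place mt.
Qed.

(** s x and Phi_Q(x) are both congruent to x^(q^(deg Q)), so their difference is a P^n-torsion point
    that is a nonunit, hence zero. *)
Lemma frobenius_torsion (s : autg iota L) n x : is_frobenius Q s ->
  torsion iota (P ^+ n) x -> s x = ev Q x.
Proof.
have iL : intermediate iota L by apply: intermediate_adjoin.
move=> [V pV frobV] tx; have Lx := torsion_sub tx.
have Pnm : P ^+ n \is monic by rewrite monic_exp // prP.1.
have Vx : V x.
  apply: (place_integral iL pV (carlitz_poly_monic Pnm).1 Lx).
  by rewrite rootE -carlitz_eval_poly tx.
apply/eqP; rewrite -subr_eq0; apply/eqP.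
apply: (torsion_nonunit iL pV (a := P ^+ n)); first exact: prime_ndvd_expr.
  by apply: torsionB; [apply: autg_torsion | apply: torsion_eval].
have -> : s x - ev Q x = (s x - x ^+ (q ^ deg Q)) - (ev Q x - x ^+ (q ^ deg Q)).
  by rewrite opprB addrA subrK.
apply: (nonunitB iL pV); first exact: frobV.
rewrite (@carlitz_evalE _ _ iota (deg Q).+1) ?prime_size // big_ord_recr /=.
rewrite coef_carlitz_lead (monicP prQ.1) rmorph1 mul1r addrK.
apply: (nonunit_sum iL pV) => i _; apply: (nonunitMr pV); last exact: (placeX pV).
by apply/(nonunit_ofA pV)/dvdrE/prime_dvd_coef_carlitz.
Qed.

End Frobenius.
End Tower.

(** * The formal Carlitz module as a P-adic limit *)

Section FormalCarlitz.
Variables (F : finFieldType) (P : {poly F}) (Ap : comUnitRingType).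
Variables (iA : {rmorphism {poly F} -> Ap}) (hAp : adic_completion P iA).
Notation A := {poly F}.
Notation Pi := (iA P).
Implicit Types (a : Ap) (u w : A).

Lemma adic_dense_dvd n a u w : dvdr (Pi ^+ n) (a - iA u) -> dvdr (Pi ^+ n) (a - iA w) ->
  dvdr (P ^+ n) (u - w).
Proof.
move=> /dvdr_sub_sym hu hw; apply/(adic_dvd hAp); rewrite rmorphB.
exact: dvdr_sub_trans hu hw.
Qed.

Lemma coef_carlitz_congr n u w i : dvdr (P ^+ n) (u - w) ->
  dvdr (Pi ^+ (n - i)) (iA (carlitz u)`_i - iA (carlitz w)`_i).
Proof.
move=> [b e]; rewrite -rmorphB -coefB -carlitzB e -rmorphXn.
exact/dvdr_rmorph/dvd_coef_carlitz_exp.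
Qed.

(** The coefficient of tau^i loses at most i powers of P, by [dvd_coef_carlitz_exp]. So it converges
    along every sequence of polynomials tending to a, to a common limit, with the stated
    precision. *)
Lemma formal_carlitzP a u n i : dvdr (Pi ^+ n) (a - iA u) ->
  dvdr (Pi ^+ (n - i)) (formal_carlitz P iA a i - iA (carlitz u)`_i).
Proof.
move=> hu; pose w k := projT1 (cid (adic_dense hAp k a)).
have wP k : dvdr (Pi ^+ k) (a - iA (w k)) by rewrite /w; case: cid.
(* The shift by i offsets that loss, so the k-th term is correct modulo P^k. *)
have [k|c hc] := @adic_complete_rate _ _ _ _ hAp (fun k => iA (carlitz (w (k +
  i)%N))`_i).
  rewrite -{1}[k](addnK i); apply/coef_carlitz_congr/(@adic_dense_dvd _ a) => //.
  by apply: dvdr_expW (wP _); rewrite addSn.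
have lim_c (z : nat -> A) : adic_cvg Pi (iA \o z) a ->
  adic_cvg Pi (fun k => iA (carlitz (z k))`_i) c.
  move=> za k; have [N zN] := za (k + i)%N; exists N => m /zN /dvdr_sub_sym zm.
  apply: dvdr_sub_trans (hc k); rewrite -{1}[k](addnK i).
  exact/coef_carlitz_congr/(@adic_dense_dvd _ a).
rewrite /formal_carlitz; case: xgetP => [c' _ lim_c'|/(_ c)]; last by case.
have wa : adic_cvg Pi (iA \o w) a.
  by move=> k; exists k => m km; apply/dvdr_sub_sym/(dvdr_expW km).
have [N hN] := lim_c' w wa (n - i)%N.
apply: dvdr_sub_trans (dvdr_sub_sym (hN (maxn N n) (leq_maxl _ _))) _.
apply/coef_carlitz_congr/(@adic_dense_dvd _ a) => //.
exact: dvdr_expW (leq_maxr _ _) (wP _).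
Qed.

(** The inverses of b modulo P^k form a Cauchy sequence, whose limit inverts b. *)
Lemma unit_of_prime (b : A) : is_prime P -> ~~ (P %| b) -> iA b \is a GRing.unit.
Proof.
move=> prP nPb; pose w k := projT1 (cid (prime_bezout k prP nPb)).
have wP k : dvdr (P ^+ k) (b * w k - 1) by rewrite /w; case: cid.
have [k|y hy] := @adic_complete_rate _ _ _ _ hAp (iA \o w).
  rewrite /= -rmorphB -rmorphXn; apply: dvdr_rmorph.
  have -> : w k.+1 - w k = w k * (b * w k.+1 - 1) - w k.+1 * (b * w k - 1) by ring.
  by apply: dvdrB; apply: dvdr_mull => //; apply: dvdr_expW (wP _).
apply/unitrPr; exists y; apply: (adic_eq hAp) => k.
apply: (dvdr_sub_trans (y := iA b * iA (w k))).
  by rewrite -mulrBr; apply/dvdr_mull/dvdr_sub_sym.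
by rewrite -rmorphM -(rmorph1 iA) -rmorphB -rmorphXn; apply: dvdr_rmorph.
Qed.

End FormalCarlitz.

Lemma exprn_lt_eps (R : realType) (r eps : R) : 0 <= r -> r < 1 -> 0 < eps ->
  exists k, r ^+ k < eps.
Proof.
move=> r0 r1 e0; pose h := 1 - r; have h0 : 0 < h by rewrite subr_gt0.
(* Bernoulli's inequality, in a form free of division by r. *)
have bern k : r ^+ k * (1 + k%:R * h) <= 1.
  elim: k => [|k IH]; first by rewrite mul0r addr0 mulr1.
  apply: le_trans IH; rewrite exprSr -mulrA ler_wpM2l ?exprn_ge0 //.
  have -> : r * (1 + k.+1%:R * h) = 1 + k%:R * h - k.+1%:R * h ^+ 2.
    by rewrite -natr1 /h; ring.
  by rewrite gerBl mulr_ge0 // sqr_ge0.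
pose k := Num.bound ((eps * h)^-1).
have hk : (eps * h)^-1 < k%:R by rewrite /k archi_boundP // invr_ge0 mulr_ge0 // ltW.
exists k; have pos : 0 < 1 + k%:R * h by rewrite ltr_pwDl // mulr_ge0 // ltW.
rewrite -(ltr_pM2r pos); apply: le_lt_trans (bern k) _.
move: hk; rewrite -(ltr_pM2r (mulr_gt0 e0 h0)) mulVf ?lt0r_neq0 ?mulr_gt0 // => hk.
by rewrite mulrDr mulr1 (lt_le_trans hk) // mulrCA lerDr ltW.
Qed.

(** * Convergence in C_P and the computation of [kappa] *)

Section AbsoluteValue.
Variables (F : finFieldType) (P : {poly F}) (prP : is_prime P).
Variables (Ap : comUnitRingType) (iA : {rmorphism {poly F} -> Ap}).
Hypothesis hAp : adic_completion P iA.
Variables (R : realType) (Cp : fieldType) (iC : {rmorphism Ap -> Cp}) (v : Cp -> R).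
Hypothesis hCp : is_Cp P iA iC v.
Notation A := {poly F}.
Notation q := #|F|.
Notation Pi := (iA P).
Implicit Types x y z : Cp.

Lemma abs0 : v 0 = 0. Proof. by apply/(Cp_eq0 hCp). Qed.

Lemma abs_gt0 x : x != 0 -> 0 < v x.
Proof.
move=> x0; rewrite lt_neqAle (Cp_ge0 hCp) andbT eq_sym.
by apply: contraNneq x0 => /(Cp_eq0 hCp) ->.
Qed.

Lemma abs1 : v 1 = 1.
Proof.
have v1 := abs_gt0 (oner_neq0 Cp).
by apply: (mulfI (lt0r_neq0 v1)); rewrite -(Cp_mul hCp) !mulr1.
Qed.

Lemma absX x n : v (x ^+ n) = v x ^+ n.
Proof. by elim: n => [|n IH]; rewrite ?abs1 // !exprS (Cp_mul hCp) IH. Qed.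

Lemma absN x : v (- x) = v x.
Proof.
have : v (-1) ^+ 2 = 1 by rewrite -absX sqrrN expr1n abs1.
move/eqP; rewrite sqrf_eq1 => /orP[/eqP vN|/eqP vN];
  first by rewrite -mulN1r (Cp_mul hCp) vN mul1r.
by have := Cp_ge0 hCp (-1); rewrite vN lerNr oppr0 ler10.
Qed.

Lemma abs_lt_add x y e : v x < e -> v y < e -> v (x + y) < e.
Proof.
by move=> vx vy; apply: le_lt_trans (Cp_ultra hCp x y) _; rewrite gt_max vx vy.
Qed.

Lemma abs_lt_sum (I : Type) (r : seq I) (D : pred I) (h : I -> Cp) e : 0 < e ->
  (forall i, D i -> v (h i) < e) -> v (\sum_(i <- r | D i) h i) < e.
Proof.
move=> e0 hh; elim/big_ind: _ => //; first by rewrite abs0.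
by move=> x y; apply: abs_lt_add.
Qed.

Lemma cvg_abs_unique u x y : cvg_abs v u x -> cvg_abs v u y -> x = y.
Proof.
move=> ux uy; apply/eqP; rewrite -subr_eq0; apply: contraT => xy.
have e0 := abs_gt0 xy; have [M hM] := ux _ e0; have [N hN] := uy _ e0.
have hx := hM _ (leq_maxl M N); have hy := hN _ (leq_maxr M N).
have := abs_lt_add (x := - (u (maxn M N) - x)) (y := u (maxn M N) - y) (e := v (x - y)).
rewrite absN => /(_ hx hy); rewrite opprB addrA subrK ltxx //.
Qed.

Let rho : R := (q ^ deg P)%:R^-1.

Let rho01 : 0 < rho < 1.
Proof.
have q1 : (1 < q ^ deg P)%N.
  by rewrite -{1}(expn0 q) ltn_exp2l ?prime_deg // finNzRing_gt1.
by rewrite invr_gt0 ltr0n (ltn_trans _ q1) //= invf_lt1 ?ltr1n // ltr0n (ltn_trans _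
  q1).
Qed.

Let abs_dvd n (a : Ap) : dvdr (Pi ^+ n) a -> v (iC a) <= rho ^+ n.
Proof.
have [r0 _] := andP rho01.
move=> [b ->]; rewrite rmorphM rmorphXn (Cp_mul hCp) absX (Cp_unif hCp).
by rewrite ler_piMr ?exprn_ge0 ?(ltW r0) // (Cp_int hCp).
Qed.

Variables (E : closedFieldType) (iota : {rmorphism {fraction A} -> E}).
Variables (j : {rmorphism E -> Cp}) (hj : forall a, j (ofA iota a) = iC (iA a)).
Notation ev := (carlitz_eval iota).

Let j_eval (a : A) N e : (size a <= N)%N ->
  j (ev a e) = \sum_(i < N) iC (iA (carlitz a)`_i) * j e ^+ (q ^ i).
Proof.
move=> aN; rewrite (carlitz_evalE _ _ aN) rmorph_sum; apply: eq_bigr => i _.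
by rewrite rmorphM rmorphXn /= hj.
Qed.

(* Because Phi_P = tau^d modulo P. *)
Lemma abs_torsion_lt1 n e : torsion iota (P ^+ n) e -> v (j e) < 1.
Proof.
have [r0 r1] := andP rho01; elim: n e => [|n IH] e.
  by rewrite /torsion /= carlitz_eval1 => ->; rewrite rmorph0 abs0.
rewrite /torsion /= exprSr carlitz_evalM => /IH lt1.
(* If |e| >= 1, then the top term e^(q^d) of Phi_P(e) strictly dominates: the lower coefficients
   have absolute value at most |P| < 1, and Phi_P(e) itself is small by induction. *)
rewrite ltNge; apply/negP => ge1.
have T1 k : 1 <= v (j e) ^+ k by rewrite exprn_ege1.
have T0 k : 0 < v (j e) ^+ k by apply: lt_le_trans (T1 k).
have : v (j e ^+ (q ^ deg P)) < v (j e) ^+ (q ^ deg P).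
  have -> : j e ^+ (q ^ deg P) = j (ev P e) -
      \sum_(i < deg P) iC (iA (carlitz P)`_i) * j e ^+ (q ^ i).
    rewrite (@j_eval _ (deg P).+1) ?prime_size // big_ord_recr /=.
    by rewrite coef_carlitz_lead (monicP prP.1) !rmorph1 mul1r addrAC subrr add0r.
  apply: abs_lt_add; first exact: lt_le_trans lt1 (T1 _).
  rewrite absN; apply: abs_lt_sum => // i _.
  rewrite (Cp_mul hCp) absX.
  have h1 : v (iC (iA (carlitz P)`_i)) <= rho.
    rewrite -[rho]expr1; apply: abs_dvd; rewrite expr1.
    by apply/dvdr_rmorph/dvdrE/prime_dvd_coef_carlitz.
  apply: le_lt_trans (_ : rho * v (j e) ^+ (q ^ deg P) < _).
    apply: ler_pM; rewrite ?(Cp_ge0 hCp) ?(ltW (T0 _)) //.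
    by rewrite ler_weXn2l // leq_pexp2l // ltnW // finNzRing_gt1.
  by rewrite gtr_pMl.
by rewrite absX ltxx.
Qed.

(** Since u matters only modulo P^n, it may be replaced by a polynomial w much closer to a; the
    series is then compared with the finite sum Phi_w(e) term by term. *)
Lemma formal_carlitz_torsion n e (a : Ap) (u : A) : torsion iota (P ^+ n) e ->
  dvdr (Pi ^+ n) (a - iA u) ->
  cvg_abs v (fun N => \sum_(i < N) iC (formal_carlitz P iA a i) * j e ^+ (q ^ i)) (j
    (ev u e)).
Proof.
move=> te au eps eps0; have [r0 r1] := andP rho01.
(* The i-th error is at most |P|^(k-i) |e|^i, hence at most r^k; for i > k the truncated k - i is 0
   and the factor |e|^i suffices. *)
have e1 := abs_torsion_lt1 te; pose r := Num.max rho (v (j e)).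
have rlt1 : r < 1 by rewrite gt_max r1.
have rge0 : 0 <= r by rewrite le_max (ltW r0).
have [k0 hk0] := exprn_lt_eps rge0 rlt1 eps0.
pose k := maxn n k0; have [w aw] := adic_dense hAp k a.
have -> : ev u e = ev w e.
  apply: (carlitz_eval_congr te); apply: (adic_dense_dvd hAp au).
  exact: dvdr_expW (leq_maxl _ _) aw.
exists (size w) => N wN; rewrite (j_eval _ wN) -sumrB; apply: abs_lt_sum => // i _.
rewrite -mulrBl -rmorphB (Cp_mul hCp) absX.
have h := abs_dvd (formal_carlitzP hAp i aw).
apply: le_lt_trans hk0; apply: le_trans (_ : r ^+ (k - i + i) <= _); last first.
  by apply: ler_wiXn2l => //; [exact: ltW | by rewrite addnC; apply:
    leq_trans (leq_maxr n k0) _; rewrite -leq_subLR].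
rewrite exprD; apply: ler_pM; rewrite ?(Cp_ge0 hCp) ?exprn_ge0 ?(Cp_ge0 hCp) //.
  by apply: le_trans h _; rewrite lerXn2r ?nnegrE ?(ltW r0) // le_max lexx.
apply: le_trans (_ : v (j e) ^+ i <= _).
  apply: ler_wiXn2l; rewrite ?(Cp_ge0 hCp) ?(ltW e1) //.
  exact/ltnW/ltn_expl/finNzRing_gt1.
by rewrite lerXn2r ?nnegrE ?(Cp_ge0 hCp) // le_max lexx orbT.
Qed.

(** For uniqueness, approximate two candidates by polynomials u and w. They act alike on a generator
    of Phi[P^n], whose annihilator is (P^n), so u = w modulo P^n, for every n. *)
Lemma kappaE (s : autg iota (cyclotomic_tower iota P)) (a : Ap) : a \is a GRing.unit ->
  (forall n e u, torsion iota (P ^+ n) e -> dvdr (Pi ^+ n) (a - iA u) ->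
    s e = ev u e) ->
  kappa iA iC v j s = a.
Proof.
move=> ua sa; rewrite /kappa; case: xgetP => [b _ [ub sb]|/(_ a) []]; last first.
  split=> // n e te; have [u au] := adic_dense hAp n a.
  by rewrite (sa n e u) //; exact: (formal_carlitz_torsion te au).
apply: (adic_eq hAp) => n; have [u au] := adic_dense hAp n a;
  have [w bw] := adic_dense hAp n b.
have [l [tl ann _]] := torsion_generator iota prP n.
have : ev w l = ev u l.
  apply: (fmorph_inj j); rewrite -(sa n l u) //.
  exact: cvg_abs_unique (formal_carlitz_torsion tl bw) (sb _ _ tl).
move/eqP; rewrite -subr_eq0 -carlitz_evalBl => /eqP/ann/(dvdr_rmorph iA).
rewrite rmorphXn rmorphB => wu; apply: dvdr_sub_trans bw _.
exact/(dvdr_sub_trans wu)/dvdr_sub_sym.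
Qed.

(** If u approximates b^-1 modulo P^n, then e = Phi_b(Phi_u(e)) for e in Phi[P^n], and g, which
    undoes Phi_b, sends e to Phi_u(e). *)
Lemma kappa_inv (g : autg iota (max_abelian iota P)) (b : A) :
  (forall x : E, algebraicOver iota x) -> ~~ (P %| b) ->
  (forall n e, torsion iota (P ^+ n) e -> g (ev b e) = e) ->
  kappa iA iC v j (autg_res (cyclotomic_tower iota P) g) = (iA b)^-1.
Proof.
move=> hE nPb gb; have ub := unit_of_prime hAp prP nPb.
apply: kappaE; first by rewrite unitrV.
move=> n e u te ue; rewrite (tower_resE hE prP) //; last exact: (torsion_tower te).
have bu : dvdr (P ^+ n) (1 - b * u).
  apply/(adic_dvd hAp); rewrite rmorphB rmorph1 rmorphM -(mulrV ub) -mulrBr.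
  exact: dvdr_mull.
rewrite -{1}[e](carlitz_eval1 iota) (carlitz_eval_congr te bu) carlitz_evalM.
by rewrite (gb n) //; apply: torsion_eval.
Qed.

End AbsoluteValue.

(** * The Euler product *)

Section GeometricSeries.
Variables (R : nzRingType) (g : R) (d : nat) (d0 : (0 < d)%N).

Let f : pseries R := fun k => (k == 0%N)%:R - g *+ (k == d).
Let geom : pseries R := fun k => g ^+ (k %/ d) *+ (d %| k)%N.

Let geomE n : geom n = (n == 0%N)%:R + (if (d <= n)%N then g * geom (n - d)%N else 0).
Proof.
rewrite /geom; have [dn|nd] := leqP d n.
  rewrite -{1 2 3}(subnK dn) dvdn_addl // divnDr // divnn d0 addn1 exprS mulrnAr.
  by rewrite addn_eq0 (gtn_eqF d0) andbF add0r.
rewrite addr0 divn_small // expr0; congr (_ *+ _); have [->|n0] := eqVneq n 0%N;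
  first by rewrite dvdn0.
by rewrite gtnNdvd // lt0n.
Qed.

Let geomC n : g * geom n = geom n * g.
Proof. by rewrite /geom mulrnAr mulrnAl -exprS exprSr. Qed.

Let mulfL (x : pseries R) n :
  ps_mul f x n = x n - (if (d <= n)%N then g * x (n - d)%N else 0).
Proof.
rewrite /ps_mul; under eq_bigr => k _ do rewrite mulrBl.
rewrite sumrB (bigD1 ord0) //= mul1r subn0 [X in _ + X - _]big1 ?addr0; last first.
  by move=> k k0; rewrite (_ : (k == 0 :> nat) = false) ?mul0r //; apply/negbTE.
congr (_ - _); have [dn|nd] := leqP d n.
  have dn1 : (d < n.+1)%N by [].
  rewrite (bigD1 (Ordinal dn1)) //= eqxx mulr1n big1 ?addr0 // => k kd.
  by rewrite (_ : (k == d :> nat) = false) ?mul0r //; apply/negbTE.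
rewrite big1 // => k _; rewrite ltn_eqF ?mul0r //.
by apply: leq_ltn_trans nd; rewrite -ltnS.
Qed.

Let mulfR (x : pseries R) n :
  ps_mul x f n = x n - (if (d <= n)%N then x (n - d)%N * g else 0).
Proof.
rewrite /ps_mul (reindex_inj rev_ord_inj) /=.
under eq_bigr => k _ do rewrite subSS subKn -1?ltnS // mulrBr.
rewrite sumrB (bigD1 ord0) //= mulr1 subn0 [X in _ + X - _]big1 ?addr0; last first.
  by move=> k k0; rewrite (_ : (k == 0 :> nat) = false) ?mulr0 //; apply/negbTE.
congr (_ - _); have [dn|nd] := leqP d n.
  have dn1 : (d < n.+1)%N by [].
  rewrite (bigD1 (Ordinal dn1)) //= eqxx mulr1n big1 ?addr0 // => k kd.
  by rewrite (_ : (k == d :> nat) = false) ?mulr0 //; apply/negbTE.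
rewrite big1 // => k _; rewrite ltn_eqF ?mulr0 //.
by apply: leq_ltn_trans nd; rewrite -ltnS.
Qed.

(** The coefficient ring need not be commutative, but g commutes with its powers, so the geometric
    series is a two-sided inverse. The equation f x = 1 determines x recursively since d > 0. *)
Lemma ps_inv_geom : ps_inv f = geom.
Proof.
rewrite /ps_inv; case: xgetP => [x _ [fx _]|/(_ geom) []]; last first.
  split; apply/funext => n; [rewrite mulfL | rewrite mulfR -geomC];
    by rewrite geomE addrK.
apply/funext => n; have [m] := ubnP n; elim: m n => // m IH n nm.
have := congr1 (fun h : pseries R => h n) fx; rewrite mulfL => /eqP.
rewrite subr_eq geomE => /eqP ->; rewrite /ps_one; case: leqP => // dn.
by rewrite IH // -(ltn_add2r d) subnK //; lia.
Qed.

(** The hypothesis reads t = h + g X^d t. An Euler factor is thus multiplied in by checking a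
    recurrence on coefficients. *)
Lemma ps_mul_geom (h t : pseries R) :
  (forall n, t n = h n + (if (d <= n)%N then g * t (n - d)%N else 0)) ->
  ps_mul (ps_inv f) h = t.
Proof.
have rec n : ps_mul geom h n = h n + (if (d <= n)%N then g * ps_mul geom h (n - d)%N
  else 0).
  rewrite {1}/ps_mul; under eq_bigr => k _ do rewrite geomE mulrDl.
  rewrite big_split /= (bigD1 ord0) //= mul1r subn0 [X in _ + X + _]big1 ?addr0;
    last first.
    by move=> k k0; rewrite (_ : (k == 0 :> nat) = false) ?mul0r //; apply/negbTE.
  congr (_ + _); have [dn|nd] := leqP d n; last first.
    rewrite big1 // => k _; rewrite leqNgt (_ : (k < d)%N) ?mul0r //.
    by apply: leq_ltn_trans nd; rewrite -ltnS.
  rewrite -(big_mkord xpredT (fun k => (if (d <= k)%N then g * geom (k - d)%N else 0)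
    * h (n - k)%N)).
  rewrite (big_cat_nat (n := d)) //=; last exact: leqW.
  rewrite big_nat big1 ?add0r => [|k /andP[_ kd]]; last by rewrite leqNgt kd mul0r.
  rewrite -{1}[d]add0n big_addn subSn // big_mkord /ps_mul mulr_sumr.
  by apply: eq_bigr => k _; rewrite leq_addl addnK mulrA addnC subnDA.
move=> tE; rewrite ps_inv_geom; apply/funext => n.
have [m] := ubnP n; elim: m n => // m IH n nm.
rewrite rec tE; case: leqP => // dn; rewrite IH //; lia.
Qed.

End GeometricSeries.

Section GroupRingExtension.
Variables (G : groupType).

Lemma gr_ofM (g h : G) : gr_of (g * h)%g = gr_of g * gr_of h.
Proof.
rewrite /GRing.mul /= /gr_mul /gr_of !msuppU oner_eq0 !big_seq_fset1.
by rewrite !mcoeffUU mulr1.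
Qed.

Variables (C : zmodType) (xi : G -> C).

Lemma gr_ext_of g : gr_ext xi (gr_of g) = xi g.
Proof. by rewrite /gr_ext /gr_of msuppU oner_eq0 big_seq_fset1 mcoeffUU mulr1z. Qed.

Lemma gr_ext_widen (d : {fset G}) (x : group_ring G) : (msupp x `<=` d)%fset ->
  gr_ext xi x = \sum_(g <- d) xi g *~ mcoeff g x.
Proof.
move=> xd; rewrite /gr_ext (big_fset_incl _ xd) //= => g _ /mcoeff_outdom ->.
by rewrite mulr0z.
Qed.

Lemma gr_extD (x y : group_ring G) : gr_ext xi (x + y) = gr_ext xi x + gr_ext xi y.
Proof.
rewrite (gr_ext_widen (msuppD_le x y)) (gr_ext_widen (fsubsetUl _ (msupp y))).
rewrite (gr_ext_widen (fsubsetUr (msupp x) _)) -big_split /=.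
by apply: eq_bigr => g _; rewrite mcoeffD mulrzDr.
Qed.

Lemma gr_ext_sum (I : Type) (r : seq I) (D : pred I) (h : I -> group_ring G) :
  gr_ext xi (\sum_(i <- r | D i) h i) = \sum_(i <- r | D i) gr_ext xi (h i).
Proof.
apply: (big_morph _ gr_extD); rewrite /gr_ext.
by rewrite (_ : msupp _ = fset0) ?big_seq_fset0 //; exact: msupp0.
Qed.

End GroupRingExtension.

Section EulerProduct.
Variable F : finFieldType.
Notation A := {poly F}.
Implicit Types (a b Q : A) (s : seq A).

Definition smooth s a := `[< forall Q, is_prime Q -> Q %| a -> Q \in s >].

Lemma prime_divisor a : a \is monic -> a != 1 -> exists Q, is_prime Q /\ Q %| a.
Proof.
move=> am a1; have sa : (1 < size a)%N.
  rewrite ltn_neqAle eq_sym size_poly_gt0 monic_neq0 // andbT.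
  apply: contra a1 => /size_poly1P[c c0 ac]; move: am.
  by rewrite ac monicE lead_coefC => /eqP ->.
have ex : exists n, `[< exists2 b : A, (1 < size b)%N /\ b %| a & size b = n >].
  by exists (size a); apply/asboolP; exists a.
case: (ex_minnP ex) => n /asboolP[b [sb ba] bn] bmin.
have b0 : b != 0 by rewrite -size_poly_gt0 ltnW.
have lb0 : (lead_coef b)^-1 != 0 by rewrite invr_eq0 lead_coef_eq0.
exists ((lead_coef b)^-1 *: b); rewrite dvdpZl //; split=> //; split.
  by rewrite monicE lead_coefZ mulVf // lead_coef_eq0.
split=> [|c c1]; first by rewrite size_scale.
rewrite dvdpZr // => cb; rewrite eqp_sym (eqp_ltrans (eqp_scale b lb0)) eqp_sym.
rewrite -dvdp_size_eqp // eqn_leq dvdp_leq //= bn; apply: bmin.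
apply/asboolP; exists c => //; split; last exact: dvdp_trans cb ba.
rewrite ltn_neqAle eq_sym c1 size_poly_gt0.
by apply: contraTneq cb => ->; rewrite dvd0p.
Qed.

Lemma smooth_nil a : a \is monic -> smooth [::] a = (a == 1).
Proof.
move=> am; apply/asboolP/eqP => [h|-> Q prQ]; last by move=> Q1;
  have := prime_ndvd1 prQ; rewrite Q1.
by apply/eqP/negPn/negP => /(prime_divisor am)[Q [prQ /(h _ prQ)]].
Qed.

Lemma smooth_cons_ndvd s Q a : is_prime Q -> Q \notin s ->
  smooth (Q :: s) a && ~~ (Q %| a) = smooth s a.
Proof.
move=> prQ Qs; apply/andP/asboolP => [[/asboolP h nQa] Q' prQ' Q'a|h].
  have := h Q' prQ' Q'a; rewrite inE => /predU1P[e|//].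
  by rewrite -e Q'a in nQa.
split; last by apply: contra Qs => /(h _ prQ).
by apply/asboolP => Q' prQ' Q'a; rewrite inE h ?orbT.
Qed.

Lemma smooth_cons_mul s Q b : is_prime Q -> smooth (Q :: s) (Q * b) = smooth (Q :: s) b.
Proof.
move=> prQ; apply/asboolP/asboolP => h Q' prQ' Q'b; first by apply: h => //;
  rewrite dvdp_mull.
have [->|/eqP Q'Q] := eqVneq Q' Q; first by rewrite inE eqxx.
apply: h => //; move: Q'b; rewrite prime_dvdM // => /orP[Q'dQ|//].
by have := prime_ndvd_expr 1 prQ prQ' Q'Q; rewrite expr1 Q'dQ.
Qed.

Lemma monics_dvd Q n : is_prime Q ->
  perm_eq [seq a <- monics F n | Q %| a]
    (if (deg Q <= n)%N then [seq Q * b | b <- monics F (n - deg Q)] else [::]).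
Proof.
move=> prQ; have Q0 := prime_neq0 prQ; have sQ := prime_size prQ.
apply: uniq_perm; first exact/filter_uniq/uniq_monics.
  by case: ifP => // _; rewrite map_inj_uniq ?uniq_monics // => a b /(mulfI Q0).
move=> a; rewrite mem_filter; apply/andP/idP => [[/dvdpP[b ->]]|].
  rewrite mem_monics monicMr ?prQ.1 // => /andP[bm /eqP].
  rewrite size_mul ?(monic_neq0 bm) // sQ addnS /= => sb.
  have sb0 : (0 < size b)%N by rewrite size_poly_gt0 monic_neq0.
  have dn : (deg Q <= n)%N by rewrite -ltnS -sb -{1}[deg Q]add0n ltn_add2r.
  rewrite dn.
  by rewrite mulrC map_f // mem_monics bm -subSn // -sb addnK eqxx.
case: leqP => // dn /mapP[b]; rewrite mem_monics => /andP[bm /eqP sb] ->.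
rewrite dvdp_mulIl mem_monics monicMl ?prQ.1 // bm; split=> //.
by rewrite size_mul ?(monic_neq0 bm) // sQ sb addSn addnS /= subnKC.
Qed.

Section Word.
Variables (G : groupType) (Q : A) (prQ : is_prime Q) (g : G) (w : A -> G).

(** Factors Q are stripped from a one at a time, each contributing g on the left. The fuel [size a]
    suffices for nonzero a because each division lowers the size. *)
Fixpoint extend_word_rec k a : G :=
  if k is k'.+1 then (if Q %| a then g * extend_word_rec k' (a %/ Q) else w a)%g else
    w a.

Definition extend_word a := extend_word_rec (size a) a.

Let extend_word_stable k k' a : a != 0 -> (size a <= k)%N -> (size a <= k')%N ->
  extend_word_rec k a = extend_word_rec k' a.
Proof.
elim: k k' a => [|k IH] [|k'] a a0; rewrite ?leqn0 ?size_poly_eq0 ?(negPf a0) //=.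
move=> sk sk'; case: ifP => // /dvdpP[b ab]; rewrite ab mulpK ?prime_neq0 //.
have b0 : b != 0 by apply: contraNneq a0 => b0; rewrite ab b0 mul0r.
have sb : (size b < size a)%N.
  by rewrite ab size_mul // ?prime_neq0 // (prime_size prQ) addnS /= -{1}[size
    b]addn0 ltn_add2l prime_deg.
by rewrite (IH k') // -ltnS (leq_trans sb).
Qed.

Lemma extend_word_ndvd a : ~~ (Q %| a) -> extend_word a = w a.
Proof. by rewrite /extend_word; case: (size a) => //= k /negPf ->. Qed.

Lemma extend_word_mul b : b != 0 -> extend_word (Q * b) = (g * extend_word b)%g.
Proof.
move=> b0; have s : (size b < size (Q * b)%R)%N.
  by rewrite size_mul // ?prime_neq0 // (prime_size prQ) addSn /= -{1}[size b]add0n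
    ltn_add2r prime_deg.
rewrite {1}/extend_word -(ltn_predK s) /= dvdp_mulIl mulKp ?prime_neq0 //.
by rewrite (@extend_word_stable _ (size b)) // -ltnS (ltn_predK s).
Qed.

End Word.

(* The Euler product over finitely many primes, with values in the possibly
   non-commutative ring Z[G]: the word w a multiplies the Frobenius inverses of
   the prime factors of a in the order of s, and act records what it does. *)
Lemma euler_product (G : groupType) (Fr : A -> G) (act : G -> A -> Prop) s :
  act 1%g 1 -> uniq s -> (forall Q, Q \in s -> is_prime Q) ->
  (forall Q g a, Q \in s -> act g a -> act ((Fr Q)^-1 * g)%g (Q * a)) ->
  exists w : A -> G,
    (forall n, (\big[@ps_mul _/@ps_one _]_(Q <- s)
       ps_inv (fun k => (k == 0%N)%:R - gr_of (Fr Q)^-1%g *+ (k == deg Q))) n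
     = \sum_(a <- monics F n | smooth s a) gr_of (w a)) /\
    forall a, a \is monic -> smooth s a -> act (w a) a.
Proof.
move=> act1; elim: s => [|Q s IH] us ps acts.
  exists (fun=> 1%g); split=> [n|a am]; last by rewrite smooth_nil // => /eqP ->.
  rewrite big_nil /ps_one; case: n => [|n].
    rewrite (perm_big [:: 1]) /=; last first.
      apply: uniq_perm => // [|a]; first exact: uniq_monics.
      rewrite mem_monics inE; apply/andP/eqP => [[am /eqP sa]|->];
        last by rewrite monic1 size_poly1.
      move/eqP: sa => /size_poly1P[c c0 ac]; move: am.
      by rewrite ac monicE lead_coefC => /eqP ->.
    by rewrite big_cons big_nil smooth_nil ?monic1 // eqxx addr0.
  rewrite big_seq_cond big1 // => a /andP[]; rewrite mem_monics => /andP[am sa].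
  rewrite smooth_nil // => /eqP a1; move: sa; by rewrite a1 size_poly1.
move: us => /= /andP[Qs us]; have prQ := ps Q (mem_head _ _).
have [||w [wE wact]] := IH us.
- by move=> Q' Q's; apply: ps; rewrite inE Q's orbT.
- by move=> Q' g a Q's; apply: acts; rewrite inE Q's orbT.
pose w' := extend_word Q (Fr Q)^-1%g w; exists w'; split; last first.
  move=> a; have [n] := ubnP (size a); elim: n a => // n IHa a an am sma.
  have [/dvdpP[b ab]|nQa] := boolP (Q %| a); last first.
    rewrite /w' extend_word_ndvd //; apply: wact => //.
    by rewrite -(smooth_cons_ndvd _ prQ Qs) sma.
  rewrite mulrC in ab; move: am sma an;
    rewrite ab monicMl ?prQ.1 // smooth_cons_mul // => bm smb.
  rewrite size_mul ?(prime_neq0 prQ) ?(monic_neq0 bm) // (prime_size prQ) addSn /= =>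
    sb.
  rewrite /w' extend_word_mul ?monic_neq0 //; apply: acts; first exact: mem_head.
  apply: IHa => //; rewrite ltnS in sb; apply: leq_trans sb.
  by rewrite -{1}[size b]add0n ltn_add2r prime_deg.
move=> n; rewrite big_cons.
(* The sum over monic a splits into a prime to Q, the series for s, and a = Q b, the series itself
   shifted by deg Q and multiplied by the inverse Frobenius; this is the required recurrence. *)
rewrite (@ps_mul_geom _ _ _ (prime_deg prQ) _
  (fun n => \sum_(a <- monics F n | smooth (Q :: s) a) gr_of (w' a))) //.
move=> {}n; rewrite wE (bigID (fun a => Q %| a)) /= addrC; congr (_ + _).
  apply: eq_big => a; first exact: smooth_cons_ndvd.
  by case/andP => _ nQa; rewrite /w' extend_word_ndvd.
under eq_bigl do rewrite andbC.
rewrite -big_filter_cond (perm_big _ (monics_dvd n prQ)) /=; case: leqP => dn;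
  last by rewrite big_nil.
rewrite big_map mulr_sumr big_seq_cond [RHS]big_seq_cond; apply: eq_big => b.
  by rewrite smooth_cons_mul.
rewrite mem_monics => /andP[/andP[bm _] _]; rewrite /w' extend_word_mul ?monic_neq0 //.
exact: gr_ofM.
Qed.

Lemma uniq_primes_upto (P : A) n : uniq (primes_upto P n).
Proof.
apply: filter_uniq; elim: (iota 1 n) (iota_uniq 1 n) => //= k r IH /andP[kr ur].
rewrite cat_uniq uniq_monics IH // andbT; apply/hasPn => a /flatten_mapP[k' k'r].
rewrite mem_monics => /andP[_ /eqP sa]; apply/negP;
  rewrite mem_monics sa => /andP[_ /eqP[e]].
by rewrite -e k'r in kr.
Qed.

Lemma mem_primes_upto (P : A) n Q :
  Q \in primes_upto P n <-> [/\ is_prime Q, Q <> P & (deg Q <= n)%N].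
Proof.
rewrite mem_filter; split=> [/andP[/andP[/asboolP irrQ /eqP QP]
  /flatten_mapP[k]]|[prQ QP dQ]].
  rewrite mem_iota mem_monics => /andP[k0 kn] /andP[Qm /eqP sQ]; split=> //.
  by rewrite /deg sQ /=; lia.
apply/andP; split; first by apply/andP; split; [apply/asboolP; case: prQ | apply/eqP].
apply/flatten_mapP; exists (deg Q); last by rewrite mem_monics prQ.1 prime_size //=.
by rewrite mem_iota prime_deg // add1n ltnS.
Qed.

(** A prime factor of a has degree at most n, so the truncated product already sees every factor. *)
Lemma smooth_primes_upto (P : A) n a : is_prime P -> a \in monics F n ->
  smooth (primes_upto P n) a = ~~ (P %| a).
Proof.
move=> prP; rewrite mem_monics => /andP[am /eqP sa];
  apply/asboolP/idP => [h|nPa Q prQ Qa].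
  by apply/negP => /(h _ prP)/mem_primes_upto[].
apply/mem_primes_upto; split=> //; first by move=> QP; rewrite -QP Qa in nPa.
by have := dvdp_leq (monic_neq0 am) Qa; rewrite sa prime_size.
Qed.

End EulerProduct.

Theorem theorem3p15
  (* A = F[theta] is {poly F}; the prime of A is (P) *)
  (F : finFieldType) (hq : (2 < #|F|)%N)
  (p : nat) (hp : p \in [pchar F])
  (P : {poly F}) (hP : is_prime P)
  (* A_P and Z_p *)
  (Ap : comUnitRingType) (iA : {rmorphism {poly F} -> Ap})
  (hAp : adic_completion P iA)
  (Zp : comNzRingType) (iZ : {rmorphism int -> Zp})
  (hZp : adic_completion p%:Z iZ)
  (* C_P with its absolute value *)
  (R : realType) (Cp : fieldType) (iC : {rmorphism Ap -> Cp}) (v : Cp -> R)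
  (hCp : is_Cp P iA iC v)
  (* an algebraic closure E of F(theta), embedded in C_P *)
  (E : closedFieldType) (iota : {rmorphism {fraction {poly F}} -> E})
  (hE : forall x, algebraicOver iota x)
  (j : {rmorphism E -> Cp}) (hj : forall a, j (ofA iota a) = iC (iA a))
  (* the arithmetic Frobenius elements of G_S *)
  (Fr : {poly F} -> autg iota (max_abelian iota P))
  (hFr : forall Q, is_prime Q -> Q <> P -> is_frobenius Q (Fr Q))
  (* s = (y, i) *)
  (y : Zp) (i : 'Z_(#|F| ^ deg P - 1)) :
  (fun n => gr_ext (xi p iA iZ iC v j (- (y, i))) (stickelberger P Fr n))
  = (fun n => iC (adic_L p iA iZ y i n)).
Proof.
apply/funext => n.
have pr_p : prime p := pcharf_prime hp.
have pAp : p%:R = 0 :> Ap.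
  by rewrite -(rmorph_nat (iA \o polyC)) (pcharf0 hp) rmorph0.
(* The invariant of the words: g inverts Phi_a on Phi[P^oo]. Left multiplication by Fr_Q^-1 turns it
   into the invariant for Q a, because Fr_Q acts there as Phi_Q. *)
pose act (g : autg iota (max_abelian iota P)) (a : {poly F}) :=
  forall m e, torsion iota (P ^+ m) e -> g (carlitz_eval iota a e) = e.
have [|||Q g a|w [wE wact]] := @euler_product F _ Fr act (primes_upto P n).
- by move=> m e _; rewrite carlitz_eval1.
- exact: uniq_primes_upto.
- by move=> Q /mem_primes_upto[].
- move=> /mem_primes_upto[prQ QP _] ga m e te.
  rewrite mulrC carlitz_evalM /= (ga m) //; last exact: torsion_eval.
  rewrite -(frobenius_torsion hE hP prQ QP (hFr _ prQ QP) te).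
  exact: (autgVK (Fr Q) e).
rewrite /stickelberger wE gr_ext_sum /adic_L rmorph_sum big_seq_cond [RHS]big_seq_cond.
apply: eq_big => [a|a /andP[am sma]].
  by case: (boolP (a \in _)) => //= am; rewrite smooth_primes_upto.
rewrite gr_ext_of /xi; congr (iC _).
have nPa : ~~ (P %| a) by rewrite -(smooth_primes_upto hP am).
have amon : a \is monic by move: am; rewrite mem_monics => /andP[].
rewrite (kappa_inv hP hAp hCp hj hE nPa (wact a amon sma)).
by rewrite (adic_powVN hq hP hAp pr_p pAp hZp) // (unit_of_prime hAp hP nPa).
Qed.
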